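(* Let $\mu\in\{+,-\}$, $k\in[1,2h-1]$, $u\in\mathbb{Z}_{q-1}$, and let $d$ be an integer with $|d|\le 2h$. Put $k_+=k$, $k_-=2h-k$, and let $X_1=A_k^{\mu u+d}$, $X_2=A_{k_\mu}^u$ in $\mathcal{E}(\mathrm{SL}(2,q))$, $X=X_1\odot X_2$. Write $$X_{[\mu\mathbf e]}\cong n_0\mathbf 1\oplus m_0V\oplus\bigoplus_{\sigma=1}^{2h-1}n_\sigma W_\sigma\oplus\bigoplus_{\phi=1}^{2h}m_\phi X_\phi\oplus n'W'\oplus n''W''\oplus m'X'\oplus m''X''$$ as a representation of $\mathrm{SL}(2,q)$. Then: (1) if $d$ is even, $$n'=n''=1+\delta_{|d|}^{2h},\quad n_0=\delta_d^0,\quad n_\sigma=2\delta_{2\mid\sigma}+\delta_{|d|}^{\sigma},\quad m'=m''=0,\quad m_0=2+\delta_d^0,\quad m_\phi=2\delta_{2\mid\phi};$$ (2) if $d$ is odd, $$n'=n''=0,\quad n_0=0,\quad n_\sigma=2\delta_{2\nmid\sigma}+\delta_{|d|}^\sigma,\quad m'=m''=1,\quad m_0=0,\quad m_\phi=2\delta_{2\nmid\phi}.$$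
   Context: General setting. For a finite group $\Gamma$, $\mathcal{E}(\Gamma)$ is the category of finite-dimensional representations of the quantum double $D(\Gamma)$. Its objects are $\Gamma$-graded finite-dimensional complex vector spaces $U=\bigoplus_{x\in\Gamma}U_x$ with a left linear action $g\mapsto L^U_g$ of $\Gamma$ with $L^U_g(U_x)=U_{gxg^{-1}}$. Tensor product: $(U\odot V)_x=\bigoplus_{x_1x_2=x}U_{x_1}\otimes V_{x_2}$ with diagonal action. For $x\in\Gamma$ and an irreducible representation $\rho$ of the centralizer $\mathrm{Cen}(x)$ on $U(\rho)$, $U(x,\rho)$ is the simple object with $U(x,\rho)_y=U(\rho)$ for $y\in[x]$ (the conjugacy class of $x$), $0$ otherwise, with the induced action: fix left coset representatives $R_x$ of $\mathrm{Cen}(x)$; for $g\in\Gamma$, $a\in R_x$ write $ga=a'b$ with $a'\in R_x$, $b\in\mathrm{Cen}(x)$, and let $L_g:U(x,\rho)_{axa^{-1}}\to U(x,\rho)_{a'xa'^{-1}}$ be $\rho(b)$. For an object $X$ and central $z$, $X_{[z]}=X_z$ is a representation of $\Gamma$. Notation. $q=p^n\ge5$, $p$ an odd prime, $q=4h+1$; $\Gamma=\mathrm{SL}(2,q)$. For integers $a<b$, $[a,b]=\{a,a+1,\dots,b\}$. Signs $\pm$ are identified with $\pm1$; $\acute{+}=0$, $\acute{-}=1$. $\check e$ is a fixed generator of $\mathbb{F}_{q^2}^\times$, $\tilde e=\check e^{2h+1}$, $e=\tilde e^2$ (a generator of $\mathbb{F}_q^\times$), $f=\check e^{4h}$; $\zeta_m=\exp(2\pi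 i/m)$. $\mathbf e$ is the identity matrix, $\mathbf a=\mathrm{diag}(e,e^{-1})$, $\mathbf b_\varepsilon=\begin{pmatrix}1&e^{\acute\varepsilon}\\0&1\end{pmatrix}$, $\mathbf{c}=\begin{pmatrix}s_1&s_1'\tilde e^{-1}\\ s_1'\tilde e&s_1\end{pmatrix}$ with $s_1=\frac12(f+f^{-1})$, $s_1'=\frac12(f-f^{-1})$. $\mathrm{Cen}(\mathbf a^k)=\langle\mathbf a\rangle\cong\mathbb{Z}_{q-1}$ for $k\in[1,2h-1]$; $A_k^u=U(\mathbf a^k,u^* )$ with $u^*(\mathbf a^i)=\zeta_{q-1}^{iu}$ (upper indices are read modulo $q-1$). $\delta_x^y$ is the Kronecker delta; $\delta_P=1$ if the condition $P$ holds and $0$ otherwise. The irreducible representations of $\mathrm{SL}(2,q)$ are $\mathbf 1$, $V$, $W_\sigma$ ($\sigma\in[1,2h-1]$), $X_\phi$ ($\phi\in[1,2h]$), $W',W'',X',X''$, with characters, listed as values at $(\mu\mathbf e;\ \mathbf a^k;\ \mu\mathbf b_\varepsilon;\ \mathbf c^\ell)$ for $\mu,\varepsilon\in\{\pm\}$, $k\in[1,2h-1]$, $\ell\in[1,2h]$, and with $s_\pm=\frac12(1\pm\sqrt q)$: $\mathbf 1$: $(1;1;1;1)$; $V$: $(q;1;0;-1)$; $W_\sigma$: $((q+1)\mu^\sigma;\ \zeta_{q-1}^{\sigma k}+\zeta_{q-1}^{-\sigma k};\ \mu^\sigma;\ 0)$; $X_\phi$: $((q-1)\mu^\phi;\ 0;\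 -\mu^\phi;\ -\zeta_{q+1}^{\phi\ell}-\zeta_{q+1}^{-\phi\ell})$; $W'$: $(2h+1;(-1)^k;s_\varepsilon;0)$; $W''$: $(2h+1;(-1)^k;s_{-\varepsilon};0)$; $X'$: $(2h\mu;0;-\mu s_\varepsilon;(-1)^{\ell+1})$; $X''$: $(2h\mu;0;-\mu s_{-\varepsilon};(-1)^{\ell+1})$. *)

(* Defs.v *)
From HB Require Import structures.
From mathcomp Require Import all_boot all_order all_algebra all_fingroup all_solvable all_field.
From mathcomp Require Import mxrepresentation character.
From mathcomp Require Import complex mxtens.
From mathcomp Require Import reals trigo.
Set Implicit Arguments.
Unset Strict Implicit.
Unset Printing Implicit Defensive.
Import Order.TTheory GroupScope GRing.Theory Num.Theory.
Local Open Scope ring_scope.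
Local Open Scope complex_scope.

Section QuantumDouble.

Variables (C : fieldType) (gT : finGroupType) (G : {group gT}).

Lemma tensmx_suml (I : finType) (P : pred I) m n p q
    (A : I -> 'M[C]_(m, n)) (B : 'M_(p, q)) :
  (\sum_(i | P i) A i) *t B = \sum_(i | P i) (A i *t B).
Proof.
by apply/matrixP=> i j; rewrite !(mxE, summxE) mulr_suml; apply: eq_bigr=> k _ /[!mxE].
Qed.

Lemma tensmx_sumr (I : finType) (P : pred I) m n p q
    (A : 'M_(m, n)) (B : I -> 'M[C]_(p, q)) :
  A *t (\sum_(i | P i) B i) = \sum_(i | P i) (A *t B i).
Proof.
by apply/matrixP=> i j; rewrite !(mxE, summxE) mulr_sumr; apply: eq_bigr=> k _ /[!mxE].
Qed.

Lemma tensmx11 m n : (1%:M : 'M[C]_m) *t (1%:M : 'M[C]_n) = 1%:M.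
Proof.
apply/matrixP=> i j; case: (mxtens_indexP i) => i1 i2.
case: (mxtens_indexP j) => j1 j2; rewrite tensmxE !mxE.
rewrite (can_eq (@mxtens_indexK _ _)) xpair_eqE -natrM mulnb.
by [].
Qed.

Lemma idem_base n (p : 'M[C]_n) : p *m p = p -> row_base p *m col_base p = 1%:M.
Proof.
move=> pp; have := mulmx_base p; have := row_base_free p.
move: (col_base p) (row_base p) (col_base_full p) => c r c_full r_free crp.
have : c *m (r *m c) *m r = c *m 1%:M *m r.
  by rewrite mulmx1 -!mulmxA crp mulmxA crp pp.
move/(row_free_inj r_free)/(row_full_inj c_full).
by [].
Qed.

(* A G-graded space U = \bigoplus_(x in G) U_x is C^n (column vectors) with   *)
(* the orthogonal idempotents p_x projecting onto U_x, so U_x is the column   *)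
(* space of p_x; L_g is a left action, and L_g U_x = U_(g x g^-1) is          *)
(* L_g p_x = p_(g x g^-1) L_g.                                                *)
Record qdobj := QDObj {
  qd_dim : nat;
  qd_act : mx_representation C G qd_dim;
  qd_proj : gT -> 'M[C]_qd_dim;
  qd_projM : {in G &, forall x y,
    qd_proj x *m qd_proj y = if x == y then qd_proj x else 0};
  qd_proj_sum : \sum_(x in G) qd_proj x = 1%:M;
  qd_actJ : {in G &, forall g x,
    qd_act g *m qd_proj x = qd_proj (g * x * g^-1)%g *m qd_act g}
}.

Section Tensor.

Variables U V : qdobj.

Definition qd_tens_act g := qd_act U g *t qd_act V g.

Definition qd_tens_proj x :=
  \sum_(x1 in G) \sum_(x2 in G | (x1 * x2)%g == x)
    (qd_proj U x1 *t qd_proj V x2).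

Lemma qd_tens_projE x : x \in G ->
  qd_tens_proj x = \sum_(y in G) (qd_proj U y *t qd_proj V (y^-1 * x)%g).
Proof.
move=> Gx; apply: eq_bigr => y Gy.
rewrite (bigD1 (y^-1 * x)%g) /=; last by rewrite groupM ?groupV // mulKVg eqxx.
rewrite big1 ?addr0 // => z /andP[/andP[_ /eqP <-]].
by rewrite mulKg eqxx.
Qed.

Lemma qd_tens_act_repr : mx_repr G qd_tens_act.
Proof.
split=> [|g k Gg Gk]; rewrite /qd_tens_act.
  by rewrite !repr_mx1; rewrite tensmx11.
by rewrite !repr_mxM // tensmx_mul.
Qed.

Lemma qd_tens_projM : {in G &, forall x y,
  qd_tens_proj x *m qd_tens_proj y = if x == y then qd_tens_proj x else 0}.
Proof.
move=> x y Gx Gy; rewrite !qd_tens_projE // mulmx_suml.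
transitivity (\sum_(i in G) if x == y then
   (qd_proj U i *t qd_proj V (i^-1 * x)%g) else 0); last first.
  by case: eqP => // _; rewrite big1.
apply: eq_bigr => i Gi; rewrite mulmx_sumr (bigD1 i) //= big1 ?addr0; last first.
  move=> j /andP[Gj ji]; rewrite tensmx_mul qd_projM // eq_sym (negPf ji).
  exact: tens0mx.
rewrite tensmx_mul !qd_projM ?groupM ?groupV // eqxx (inj_eq (mulgI _)).
by case: eqP => // _; apply: tensmx0.
Qed.

Lemma qd_tens_proj_sum : \sum_(x in G) qd_tens_proj x = 1%:M.
Proof.
rewrite (eq_bigr _ qd_tens_projE) exchange_big /=.
transitivity (\sum_(i in G) (qd_proj U i *t (1%:M : 'M[C]_(qd_dim V)))).
  apply: eq_bigr => i Gi; rewrite -tensmx_sumr -(qd_proj_sum V); congr (_ *t _).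
  rewrite (reindex_inj (mulgI i)) /=.
  by apply: eq_big => [j|j _]; rewrite ?groupMl // mulKg.
rewrite -tensmx_suml qd_proj_sum; exact: tensmx11.
Qed.

Lemma qd_tens_actJ : {in G &, forall g x,
  MxRepresentation qd_tens_act_repr g *m qd_tens_proj x
  = qd_tens_proj (g * x * g^-1)%g *m MxRepresentation qd_tens_act_repr g}.
Proof.
move=> g x Gg Gx /=; rewrite !qd_tens_projE ?groupM ?groupV //.
rewrite mulmx_sumr mulmx_suml [RHS](reindex_inj (conjg_inj g^-1%g)) /=.
apply: eq_big => [j|j Gj]; first by rewrite groupJr ?groupV.
rewrite !tensmx_mul !qd_actJ ?groupM ?groupV //.
by rewrite conjgE invgK !invMg invgK !mulgA mulgKV.
Qed.

Definition qd_tens : qdobj :=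
  QDObj qd_tens_projM qd_tens_proj_sum qd_tens_actJ.

End Tensor.

Section Component.

Variables (U : qdobj) (z : gT) (Zz : z \in 'Z(G)).

Local Notation p := (qd_proj U z).

(* U_z for central z, in the basis given by the columns of col_base p; as p   *)
(* is idempotent, row_base p is the dual basis.                               *)
Definition qd_comp_mx g : 'M[C]_(\rank p) :=
  row_base p *m qd_act U g *m col_base p.

Lemma qd_comp_mx_repr : mx_repr G qd_comp_mx.
Proof.
have /centerP[Gz cGz] := Zz.
have pp : p *m p = p by rewrite qd_projM // eqxx.
have pL g : g \in G -> qd_act U g *m p = p *m qd_act U g.
  by move=> Gg; rewrite qd_actJ // -(cGz g Gg) mulgK.
have rc : row_base p *m col_base p = 1%:M by exact: idem_base.
have rp : row_base p *m p = row_base p.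
  by rewrite -[X in _ *m X]mulmx_base mulmxA rc mul1mx.
rewrite /qd_comp_mx.
move: (row_base p) (col_base p) (mulmx_base p) rc rp => r c crp rc rp.
split=> [|g k Gg Gk]; first by rewrite repr_mx1 mulmx1 rc.
rewrite repr_mxM // !mulmxA -(mulmxA _ c r) crp -(mulmxA _ (qd_act U g) p) pL //.
by rewrite !mulmxA rp.
Qed.

Definition qd_comp : representation C G :=
  Representation (MxRepresentation qd_comp_mx_repr).

End Component.

Section Simple.

Variables (x : gT) (Gx : x \in G) (d : nat).
Variable rho : mx_representation C 'C_G[x] d.

Definition qd_reps : {set gT} := [set repr A | A in lcosets 'C_G[x] G].

Local Notation r := #|qd_reps|.

Definition qd_rep (i : 'I_r) : gT := enum_val i.

(* The basis of U(x, rho) is indexed by pairs (i, s) with s < d. As           *)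
(* g a_i = a_j b iff b = a_j^-1 g a_i, the (j, i) block of L_g is rho b if    *)
(* this b centralises x, and 0 otherwise.                                     *)
Definition qd_simple_act g : 'M[C]_(r * d) :=
  \sum_(i < r) \sum_(j < r | ((qd_rep j)^-1 * g * qd_rep i)%g \in 'C_G[x])
     (delta_mx j i *t rho ((qd_rep j)^-1 * g * qd_rep i)%g).

Definition qd_simple_proj y : 'M[C]_(r * d) :=
  \sum_(i < r | (qd_rep i * x * (qd_rep i)^-1)%g == y)
     (delta_mx i i *t 1%:M).

Lemma mem_repr_lc y : repr (y *: 'C_G[x])%g \in (y *: 'C_G[x])%g.
Proof. exact: mem_repr (lcoset_refl _ _). Qed.

Lemma qd_rep_in i : qd_rep i \in G.
Proof.
have /imsetP[A /lcosetsP[y Gy ->] ->] : qd_rep i \in qd_reps by exact: enum_valP.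
by have /lcosetP[b /setIP[Gb _] ->] := mem_repr_lc y; rewrite groupM.
Qed.

Lemma qd_rep_ex y : y \in G -> exists j, ((qd_rep j)^-1 * y)%g \in 'C_G[x].
Proof.
move=> Gy; have aR : repr (y *: 'C_G[x])%g \in qd_reps.
  by apply: imset_f; apply/lcosetsP; exists y.
exists (enum_rank_in aR (repr (y *: 'C_G[x])%g)).
rewrite /qd_rep enum_rankK_in // -mem_lcoset lcoset_sym.
exact: mem_repr_lc.
Qed.

Lemma qd_rep_uniq y i j : ((qd_rep i)^-1 * y)%g \in 'C_G[x] ->
  ((qd_rep j)^-1 * y)%g \in 'C_G[x] -> i = j.
Proof.
move=> iy jy; apply: enum_val_inj; rewrite -/(qd_rep i) -/(qd_rep j).
have E k : ((qd_rep k)^-1 * y)%g \in 'C_G[x] -> qd_rep k = repr (y *: 'C_G[x])%g.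
  rewrite -mem_lcoset => /lcoset_eqP ->.
  have /imsetP[A /lcosetsP[w Gw ->] ->] : qd_rep k \in qd_reps by exact: enum_valP.
  congr repr; apply/lcoset_eqP; rewrite lcoset_sym; exact: mem_repr_lc.
by rewrite (E i iy) (E j jy).
Qed.

Lemma qd_rep_pred1 g i l : ((qd_rep l)^-1 * g * qd_rep i)%g \in 'C_G[x] ->
  forall j, (((qd_rep j)^-1 * g * qd_rep i)%g \in 'C_G[x]) = (j == l).
Proof.
move=> Hl j; apply/idP/eqP => [Hj|-> //].
rewrite -mulgA in Hl; rewrite -mulgA in Hj.
exact: qd_rep_uniq Hj Hl.
Qed.

Lemma qd_simple_act_repr : mx_repr G qd_simple_act.
Proof.
split=> [|g k Gg Gk]; rewrite /qd_simple_act.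
  rewrite -tensmx11 [X in X *t _]mx1_sum_delta tensmx_suml; apply: eq_bigr => i _.
  rewrite (bigD1 i) /= ?mulg1 ?mulVg ?group1 // repr_mx1 big1 ?addr0 //.
  move=> j /andP[+ /eqP ji]; rewrite mulg1 => Hj; case: ji.
  by apply: qd_rep_uniq Hj _; rewrite mulVg group1.
rewrite mulmx_sumr; apply: eq_bigr => i _.
have [l Hl] := qd_rep_ex (groupM Gk (qd_rep_in i)).
rewrite mulgA in Hl; rewrite (big_pred1 l (qd_rep_pred1 Hl)).
rewrite mulmx_suml [RHS](bigD1 l) //= [X in _ + X]big1 ?addr0; last first.
  move=> l' l'l; rewrite mulmx_suml big1 // => j _.
  by rewrite tensmx_mul mul_delta_mx_0 // tens0mx.
rewrite mulmx_suml; apply: eq_big => [j|j Hj].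
  by rewrite -[RHS](groupMr _ Hl) !mulgA mulgK.
have Hj' : ((qd_rep j)^-1 * g * qd_rep l)%g \in 'C_G[x].
  by rewrite -(groupMr _ Hl) !mulgA mulgK -(mulgA _ g k).
rewrite tensmx_mul mul_delta_mx -repr_mxM //; congr (_ *t rho _).
by rewrite !mulgA mulgK.
Qed.

Lemma qd_simple_projM : {in G &, forall y z,
  qd_simple_proj y *m qd_simple_proj z = if y == z then qd_simple_proj y else 0}.
Proof.
move=> y z _ _; rewrite /qd_simple_proj mulmx_suml.
transitivity (\sum_(i < r | (qd_rep i * x * (qd_rep i)^-1)%g == y)
   if y == z then delta_mx i i *t (1%:M : 'M[C]_d) else 0); last first.
  by case: eqP => // _; rewrite big1.
apply: eq_bigr => i /eqP iy; rewrite mulmx_sumr big_mkcond (bigD1 i) //=.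
rewrite big1 ?addr0 => [|j ji]; last first.
  by case: ifP => // _; rewrite tensmx_mul mul_delta_mx_0 1?eq_sym // tens0mx.
by rewrite iy; case: ifP => // _; rewrite tensmx_mul mul_delta_mx mulmx1.
Qed.

Lemma qd_simple_proj_sum : \sum_(y in G) qd_simple_proj y = 1%:M.
Proof.
rewrite /qd_simple_proj (exchange_big_dep predT) //= -tensmx11 [X in X *t _]mx1_sum_delta tensmx_suml.
apply: eq_bigr => i _; rewrite (big_pred1 (qd_rep i * x * (qd_rep i)^-1)%g) //.
move=> y; rewrite /= [RHS]eq_sym; case: eqP => [<-|]; rewrite ?andbF ?andbT //.
by rewrite !groupM ?groupV ?qd_rep_in.
Qed.

Lemma qd_simple_actJ : {in G &, forall g y,
  MxRepresentation qd_simple_act_repr g *m qd_simple_proj y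
  = qd_simple_proj (g * y * g^-1)%g *m MxRepresentation qd_simple_act_repr g}.
Proof.
move=> g y Gg Gy /=; rewrite /qd_simple_act /qd_simple_proj.
rewrite mulmx_suml mulmx_sumr; apply: eq_bigr => i _.
have [l Hl] := qd_rep_ex (groupM Gg (qd_rep_in i)).
rewrite mulgA in Hl; rewrite (big_pred1 l (qd_rep_pred1 Hl)).
have cond : ((qd_rep l * x * (qd_rep l)^-1)%g == (g * y * g^-1)%g)
    = ((qd_rep i * x * (qd_rep i)^-1)%g == y).
  have [b xb ga] : exists2 b, (b * x = x * b)%g & (g * qd_rep i = qd_rep l * b)%g.
    exists ((qd_rep l)^-1 * g * qd_rep i)%g; last by rewrite !mulgA mulgV mul1g.
    by have /setIP[_ /cent1P] := Hl.
  have -> : (qd_rep l * x * (qd_rep l)^-1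
      = g * (qd_rep i * x * (qd_rep i)^-1) * g^-1)%g.
    transitivity ((g * qd_rep i) * x * (g * qd_rep i)^-1)%g.
      by rewrite ga invMg -!mulgA (mulgA b) xb -(mulgA x) mulKVg.
    by rewrite invMg !mulgA.
  by rewrite (inj_eq (mulIg _)) (inj_eq (mulgI _)).
rewrite mulmx_sumr mulmx_suml big_mkcond [RHS]big_mkcond /=.
rewrite (bigD1 i) //= big1 ?addr0 => [|j ji]; last first.
  by case: ifP => // _; rewrite tensmx_mul mul_delta_mx_0 1?eq_sym // tens0mx.
rewrite [RHS](bigD1 l) //= big1 ?addr0 => [|j jl]; last first.
  by case: ifP => // _; rewrite tensmx_mul mul_delta_mx_0 // tens0mx.
by rewrite cond; case: ifP => // _; rewrite !tensmx_mul !mul_delta_mx mulmx1 mul1mx.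
Qed.

Definition qd_simple : qdobj :=
  QDObj qd_simple_projM qd_simple_proj_sum qd_simple_actJ.

End Simple.
End QuantumDouble.

Section SL2.

Variable F : finFieldType.

Definition SL2_set : {set {'GL_2[F]}} := [set g | \det (GLval g) == 1].

Fact SL2_group_set : group_set SL2_set.
Proof.
apply/group_setP; split=> [|g k]; rewrite !inE; first by rewrite GL_1E det1.
by move=> /eqP gd /eqP kd; rewrite GL_ME det_mulmx gd kd mulr1.
Qed.

Definition SL2 : {group {'GL_2[F]}} := Group SL2_group_set.

Definition mx2 (K : Type) (x11 x12 x21 x22 : K) : 'M[K]_2 :=
  \matrix_(i, j) if i == 0 :> nat then (if j == 0 :> nat then x11 else x12)
                 else (if j == 0 :> nat then x21 else x22).

(* The group element with matrix M (and the identity if M is singular). *)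
Definition GL2_of (M : 'M[F]_2) : {'GL_2[F]} := insubd (1%g : {'GL_2[F]}) M.

(* Signs are booleans, with true for -. *)
Definition SL2_e (mu : bool) : {'GL_2[F]} := GL2_of ((-1) ^+ mu)%:M.
Definition SL2_a (e : F) : {'GL_2[F]} := GL2_of (mx2 e 0 0 e^-1).
Definition SL2_b (e : F) (eps : bool) : {'GL_2[F]} := GL2_of (mx2 1 (e ^+ eps) 0 1).

Lemma GL2_ofK M : M \in unitmx -> GLval (GL2_of M) = M.
Proof. by move=> uM; rewrite /GL2_of insubdK. Qed.

Lemma SL2_eE mu : GLval (SL2_e mu) = ((-1) ^+ mu)%:M.
Proof. by rewrite GL2_ofK // unitmxE det_scalar unitrX // unitrX // unitrN1. Qed.

Lemma SL2_e_central mu : SL2_e mu \in 'Z(SL2).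
Proof.
apply/centerP; split=> [|g _].
  by rewrite inE SL2_eE det_scalar -exprM mulnC exprM sqrrN expr1n expr1n.
apply: val_inj; rewrite [LHS](GL_MxE (SL2_e mu)) [RHS](GL_MxE g) SL2_eE.
by rewrite scalar_mxC.
Qed.

Lemma det_mx2 (x11 x12 x21 x22 : F) :
  \det (mx2 x11 x12 x21 x22) = x11 * x22 - x12 * x21.
Proof.
rewrite (expand_det_row _ ord0) !big_ord_recl big_ord0 /cofactor !det_mx11 !mxE /=.
by rewrite expr0 mul1r expr1 addr0 mulN1r mulrN.
Qed.

Lemma SL2_a_in e k : (SL2_a e ^+ k)%g \in SL2.
Proof.
apply: groupX; rewrite /SL2_a /GL2_of; have [->|e0] := eqVneq e 0.
  rewrite /insubd insubN ?group1 //.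
  by rewrite -[_ \is a _]/(_ \in unitmx) unitmxE det_mx2 !mul0r subr0 unitr0.
have d1 : \det (mx2 e 0 0 e^-1) = 1 by rewrite det_mx2 mulfV // mul0r subr0.
by rewrite inE GL2_ofK ?d1 // unitmxE d1 unitr1.
Qed.

End SL2.

Section Zeta.

Variable R : realType.

Definition zeta (m : nat) : R[i] :=
  (cos (2 * pi / m%:R) +i* sin (2 * pi / m%:R))%C.

Definition s_pm (q : nat) (eps : bool) : R[i] :=
  (1 + (-1) ^+ eps * (Num.sqrt (q%:R : R))%:C) / 2.

End Zeta.

Section SL2Reps.

Variables (R : realType) (F : finFieldType).

Local Notation rep := (representation R[i] (SL2 F)).

Record SL2_family := SL2Family {
  irr_1 : rep;
  irr_V : rep;
  irr_W : nat -> rep;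
  irr_X : nat -> rep;
  irr_W' : rep;
  irr_W'' : rep;
  irr_X' : rep;
  irr_X'' : rep
}.

Section Table.

Variables (h : nat) (e : F) (c : {'GL_2[F]}).

Definition has_character (rho : rep)
    (val_e : bool -> R[i]) (val_a : nat -> R[i])
    (val_b : bool -> bool -> R[i]) (val_c : nat -> R[i]) : Prop :=
  [/\ forall mu, \tr (rho (SL2_e F mu)) = val_e mu,
      forall k, (1 <= k <= 2 * h - 1)%N -> \tr (rho (SL2_a e ^+ k)%g) = val_a k,
      forall mu eps, \tr (rho (SL2_e F mu * SL2_b e eps)%g) = val_b mu eps &
      forall l, (1 <= l <= 2 * h)%N -> \tr (rho (c ^+ l)%g) = val_c l].

Definition irr_with_character (rho : rep) val_e val_a val_b val_c : Prop :=
  mx_irreducible rho /\ has_character rho val_e val_a val_b val_c.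

Local Notation q := (4 * h + 1)%N.
Local Notation sgn mu := ((-1) ^+ mu : R[i]).
Local Notation z_ m := (zeta R m).
Local Notation s_ := (s_pm R q).

Definition SL2_character_table (I : SL2_family) : Prop :=
  irr_with_character (irr_1 I)
    (fun=> 1) (fun=> 1) (fun _ _ => 1) (fun=> 1) /\
  irr_with_character (irr_V I)
    (fun=> q%:R) (fun=> 1) (fun _ _ => 0) (fun=> -1) /\
  (forall s, (1 <= s <= 2 * h - 1)%N ->
    irr_with_character (irr_W I s)
      (fun mu => (q + 1)%:R * sgn mu ^+ s)
      (fun k => z_ (q - 1) ^+ (s * k) + z_ (q - 1) ^- (s * k))
      (fun mu _ => sgn mu ^+ s)
      (fun=> 0)) /\
  (forall f, (1 <= f <= 2 * h)%N ->
    irr_with_character (irr_X I f)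
      (fun mu => (q - 1)%:R * sgn mu ^+ f)
      (fun=> 0)
      (fun mu _ => - sgn mu ^+ f)
      (fun l => - z_ (q + 1) ^+ (f * l) - z_ (q + 1) ^- (f * l))) /\
  irr_with_character (irr_W' I)
    (fun=> (2 * h + 1)%:R) (fun k => (-1) ^+ k)
    (fun _ eps => s_ eps) (fun=> 0) /\
  irr_with_character (irr_W'' I)
    (fun=> (2 * h + 1)%:R) (fun k => (-1) ^+ k)
    (fun _ eps => s_ (~~ eps)) (fun=> 0) /\
  irr_with_character (irr_X' I)
    (fun mu => (2 * h)%:R * sgn mu) (fun=> 0)
    (fun mu eps => - sgn mu * s_ eps) (fun l => (-1) ^+ (l + 1)) /\
  irr_with_character (irr_X'' I)
    (fun mu => (2 * h)%:R * sgn mu) (fun=> 0)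
    (fun mu eps => - sgn mu * s_ (~~ eps)) (fun l => (-1) ^+ (l + 1)).

End Table.

Record SL2_mult := SL2Mult {
  mult_1 : nat;
  mult_V : nat;
  mult_W : nat -> nat;
  mult_X : nat -> nat;
  mult_W' : nat;
  mult_W'' : nat;
  mult_X' : nat;
  mult_X'' : nat
}.

Local Notation "U (+) V" := (dadd_grepr U V) (at level 50, left associativity).

Definition SL2_sum (h : nat) (I : SL2_family) (N : SL2_mult) : rep :=
  muln_grepr (irr_1 I) (mult_1 N) (+) muln_grepr (irr_V I) (mult_V N)
  (+) \big[dadd_grepr/grepr0]_(1 <= s < 2 * h) muln_grepr (irr_W I s) (mult_W N s)
  (+) \big[dadd_grepr/grepr0]_(1 <= f < (2 * h).+1) muln_grepr (irr_X I f) (mult_X N f)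
  (+) muln_grepr (irr_W' I) (mult_W' N) (+) muln_grepr (irr_W'' I) (mult_W'' N)
  (+) muln_grepr (irr_X' I) (mult_X' N) (+) muln_grepr (irr_X'' I) (mult_X'' N).

(* rho is the character u^* of Cen(a^k) = <[a]> given by a^i |-> zeta^(i u)   *)
(* for zeta = zeta_(q-1).                                                     *)
Definition is_star (q : nat) (e : F) (k : nat) (u : 'Z_(q - 1))
    (rho : mx_representation R[i] 'C_(SL2 F)[(SL2_a e ^+ k)%g] 1) : Prop :=
  forall i : nat, rho (SL2_a e ^+ i)%g = (zeta R (q - 1) ^+ (i * u))%:M.

Definition A_obj (e : F) (k : nat)
    (rho : mx_representation R[i] 'C_(SL2 F)[(SL2_a e ^+ k)%g] 1) :
    qdobj R[i] (SL2 F) :=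
  qd_simple (SL2_a_in e k) rho.

End SL2Reps.

(* Main.v *)
Require Import Defs.
From HB Require Import structures.
From mathcomp Require Import all_boot all_order all_algebra all_fingroup all_solvable all_field.
From mathcomp Require Import mxrepresentation character complex mxtens reals trigo.
From mathcomp Require Import zify ring lra.
Set Implicit Arguments.
Unset Strict Implicit.
Unset Printing Implicit Defensive.
Import Order.TTheory GroupScope GRing.Theory Num.Theory.
Local Open Scope ring_scope.

(* The product map identifies the homogeneous component X_[mu e] with an      *)
(* orbit of SL(2, q) whose stabiliser is the torus T = <a> = Cen(a^k); on T   *)
(* the two characters multiply to a^i |-> zeta^(d i), because the Weyl        *)
(* element w inverts T when mu = + and no twist occurs when mu = -. Hence     *)
(* X_[mu e] has the trace of the representation induced from this character,  *)
(* and by Frobenius reciprocity the multiplicity of S in it is                *)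
(* |T|^-1 \sum_i tr S(a^i) zeta^(d i), which only involves the values of the  *)
(* character table on T. Completeness of the list of irreducibles is not      *)
(* needed: the dimensions of the constituents found already add up to         *)
(* dim X_[mu e] = q (q + 1), and traces determine representations.            *)

(** * Primitive roots of unity *)

(** The reduction to the torus T, of order q - 1 = 4h, rests on three facts.
    [mxtrace_qd_simple_tens] writes the trace on the component as an induced character,
    [A_tens_fusion] identifies the inducing character of T, and [repr_dot_ind] is Frobenius
    reciprocity.

    On T every listed character is a combination, possibly zero, of powers of zeta_(q-1), plus
    corrections at the two central elements a^0 = 1 and a^(2h) = -1 ([label_trace_torus]). Paired
    with a^i |-> zeta^(d i), the combination gives the Kronecker deltas in |d|. The corrections are
    4h or 2h up to sign, or zero for the trivial representation, and after division by 4h they give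
    the parity terms: 1 + (-1)^d for V, 1 + (-1)^(d+s) for W_s and X_s, (1 + (-1)^d)/2 for W' and
    W'', (1 - (-1)^d)/2 for X' and X''. This is [label_torus_mult].

    The listed representations are pairwise orthogonal ([label_dot0]), and the multiplicities found
    fill the whole dimension ([sum_label_deg]), so [mxtrace_of_mult] and [eq_mxtrace_rsim] give the
    decomposition. Its uniqueness follows by pairing a decomposition with each listed irreducible
    ([SL2_sum_dot]). *)

Lemma sum_unity_root (K : fieldType) n (y : K) : y ^+ n = 1 ->
  \sum_(i < n) y ^+ i = n%:R * (y == 1)%:R.
Proof.
move=> yn; case: eqP => [->|/eqP y1].
  by rewrite (eq_bigr (fun=> 1)) => [|i _]; rewrite ?expr1n // sumr_const card_ord mulr1.
rewrite mulr0; apply: (@mulfI _ (y - 1)); first by rewrite subr_eq0.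
by rewrite mulr0 -subrX1 yn subrr.
Qed.

Section PrimitiveRoot.

Variables (K : fieldType) (n : nat) (z : K).
Hypothesis prim_z : n.-primitive_root z.

Lemma prim_root_neq0 : z != 0.
Proof.
by rewrite -unitfE -(unitrX_pos _ (prim_order_gt0 prim_z)) (prim_expr_order prim_z) unitr1.
Qed.

Lemma exprz_prim_eq1 (m : int) : (z ^ m == 1) = (n %| `|m|)%N.
Proof.
case: m => m; first by rewrite (prim_order_dvd prim_z).
by rewrite /= invr_eq1 (prim_order_dvd prim_z).
Qed.

Lemma prim_half h : n = h.*2 -> z ^+ h = -1.
Proof.
move=> Dn; have n_gt0 := prim_order_gt0 prim_z.
have /eqP : (z ^+ h) ^+ 2 = 1 by rewrite -exprM muln2 -Dn prim_expr_order.
rewrite sqrf_eq1 => /orP[|/eqP//]; rewrite -(prim_order_dvd prim_z) => /dvdn_leq.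
by lia.
Qed.

(** The difference of the two sides is, up to a unit, (z^s - z^t)(1 - z^(s+t)), and 0 < s + t < n
    excludes the second factor. One character value thus separates the W_s from each other, and
    likewise the X_f. *)
Lemma prim_addV_inj s t : (0 < s)%N -> (0 < t)%N -> (s.*2 < n)%N -> (t.*2 < n)%N ->
  z ^+ s + z ^- s = z ^+ t + z ^- t -> s = t.
Proof.
move=> s0 t0 sn tn E.
have nz := prim_root_neq0.
have /eqP : (z ^+ s - z ^+ t) * (1 - z ^+ (s + t)) = 0.
  have -> : (z ^+ s - z ^+ t) * (1 - z ^+ (s + t))
     = z ^+ (s + t) * ((z ^+ t + z ^- t) - (z ^+ s + z ^- s)).
    by rewrite exprD; field; rewrite !expf_neq0.
  by rewrite E subrr mulr0.
rewrite mulf_eq0 !subr_eq0 [1 == _]eq_sym -(prim_order_dvd prim_z) => /orP[|/dvdn_leq]; last lia.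
by rewrite (eq_prim_root_expr prim_z) !modn_small => [/eqP||]; lia.
Qed.

End PrimitiveRoot.

Section ZpExponent.

Variables (K : fieldType) (n : nat) (z : K).
Hypotheses (n_gt1 : (1 < n)%N) (prim_z : n.-primitive_root z).
Implicit Types x y : 'Z_n.

(** As z^n = 1, the power of z at the canonical representative depends only on the residue class;
    this is how upper indices modulo q - 1 are handled. *)
Lemma exp_Zp_nat m : z ^+ (m%:R : 'Z_n) = z ^+ m.
Proof. by rewrite val_Zp_nat // (prim_expr_mod prim_z). Qed.

Lemma exp_ZpD x y : z ^+ (x + y : 'Z_n)%R = z ^+ x * z ^+ y.
Proof. by rewrite -exprD -[RHS]exp_Zp_nat natrD !natr_Zp. Qed.

Lemma exp_ZpN x : z ^+ (- x : 'Z_n)%R = z ^- x.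
Proof.
have nz : z ^+ x != 0 by rewrite expf_neq0 // (prim_root_neq0 prim_z).
by apply: (mulIf nz); rewrite -exp_ZpD addNr expr0 mulVf.
Qed.

Lemma exp_Zp_int (m : int) : z ^+ (m%:~R : 'Z_n) = z ^ m.
Proof. by case: m => m; rewrite ?NegzE ?mulrNz ?exp_ZpN exp_Zp_nat. Qed.

End ZpExponent.

(** * Orthogonality and complete reducibility *)

Section ReprDot.

Variables (C : numClosedFieldType) (gT : finGroupType) (G : {group gT}).
Local Notation reprG := (mx_representation C G).
Local Notation rep := (representation C G).

(** The inner product of characters, with the value at g^-1 in the role of the complex conjugate. *)
Definition repr_dot m n (rU : reprG m) (rV : reprG n) : C :=
  #|G|%:R^-1 * \sum_(g in G) \tr (rU g^-1%g) * \tr (rV g).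

Lemma eq_repr_dotr m n n' (rU : reprG m) (rV : reprG n) (rV' : reprG n') :
  {in G, forall g, \tr (rV g) = \tr (rV' g)} ->
  repr_dot rU rV = repr_dot rU rV'.
Proof. by move=> eqV; congr (_ * _); apply: eq_bigr => g Gg; rewrite eqV. Qed.

Lemma mxtrace_dsum (I : Type) (r : seq I) (P : pred I) (V : I -> rep) g :
  \tr ((\big[@dadd_grepr C gT G/grepr0]_(i <- r | P i) V i) g)
  = \sum_(i <- r | P i) \tr (V i g).
Proof.
apply: (big_morph (fun V : rep => \tr (V g))) => [V1 V2|] /=; last exact: mxtrace1.
exact: mxtrace_block.
Qed.

Lemma mxtrace_dadd (V1 V2 : rep) g :
  \tr (dadd_grepr V1 V2 g) = \tr (V1 g) + \tr (V2 g).
Proof. exact: mxtrace_block. Qed.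

Lemma mxtrace_muln (V : rep) k g : \tr (muln_grepr V k g) = k%:R * \tr (V g).
Proof. by rewrite mxtrace_dsum sumr_const card_ord mulr_natl. Qed.

Lemma repr_dot_lincomb (I : Type) (r : seq I) (P : pred I) m n (rU : reprG m)
    (rV : reprG n) (a : I -> C) (W : I -> rep) :
  {in G, forall g, \tr (rV g) = \sum_(i <- r | P i) a i * \tr (W i g)} ->
  repr_dot rU rV = \sum_(i <- r | P i) a i * repr_dot rU (W i).
Proof.
move=> eqV; rewrite /repr_dot mulr_sumr.
under [RHS]eq_bigr do rewrite mulrCA mulr_sumr mulr_sumr.
rewrite [RHS]exchange_big /=; apply: eq_bigr => g Gg.
rewrite eqV // -mulr_sumr; congr (_ * _); rewrite mulr_sumr.
by apply: eq_bigr => i _; rewrite mulrCA.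
Qed.

Section Average.

Variables (m n : nat) (rU : reprG m) (rV : reprG n).

(** Averaging over G (without dividing by its order) turns any matrix into an intertwiner. *)
Definition repr_avg (M : 'M[C]_(m, n)) :=
  \sum_(g in G) rU g^-1%g *m M *m rV g.

Lemma repr_avg_hom M x : x \in G -> rU x *m repr_avg M = repr_avg M *m rV x.
Proof.
move=> Gx; rewrite mulmx_sumr mulmx_suml [LHS](reindex_inj (mulIg x)) /=.
apply: eq_big => [g|g Gg]; first by rewrite groupMr.
rewrite invMg !mulmxA -repr_mxM ?groupM ?groupV -?in_set ?mulKVg //; last first.
  by move: Gg; rewrite groupMr.
by move: Gg; rewrite groupMr // => Gg; rewrite repr_mxM // !mulmxA.
Qed.

(** Schur: the kernel and the image of an intertwiner are submodules, so a nonzero one between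
    irreducibles is invertible. *)
Lemma mx_Schur_rsim (A : 'M[C]_(m, n)) : mx_irreducible rU -> mx_irreducible rV ->
  {in G, forall x, rU x *m A = A *m rV x} -> A != 0 -> mx_rsim rU rV.
Proof.
move=> /mx_irrP[_ irrU] /mx_irrP[_ irrV] homA nzA.
have frA : row_free A.
  rewrite -kermx_eq0; apply/negPn/negP => /irrU ker_full.
  have /ker_full : mxmodule rU (kermx A).
    apply/mxmoduleP => x Gx; apply/sub_kermxP.
    by rewrite -mulmxA homA // mulmxA mulmx_ker mul0mx.
  by rewrite -sub1mx => /sub_kermxP; rewrite mul1mx => /eqP; rewrite (negPf nzA).
have flA : row_full A.
  rewrite -sub1mx -(genmxE A) sub1mx; apply: irrV.
    rewrite (eqmx_module _ (genmxE _)); apply/mxmoduleP => x Gx.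
    by rewrite -homA // submxMl.
  by rewrite -mxrank_eq0 genmxE mxrank_eq0.
by exists A => //; rewrite -(eqP frA) (eqP flA).
Qed.

(** The (i, j) entry of the average of the elementary matrix E_ij is the sum over g of rU(g^-1)_ii
    rV(g)_jj; summing over i and j yields the product of traces. *)
Lemma repr_dot_avg :
  #|G|%:R * repr_dot rU rV = \sum_i \sum_j repr_avg (delta_mx i j) i j.
Proof.
rewrite mulVKf ?pnatr_eq0 -?lt0n ?cardG_gt0 //.
transitivity (\sum_(g in G) \sum_i \sum_j rU g^-1%g i i * rV g j j).
  by apply: eq_bigr => g _; rewrite mulr_suml; apply: eq_bigr => i _; rewrite mulr_sumr.
rewrite exchange_big; apply: eq_bigr => i _.
rewrite exchange_big; apply: eq_bigr => j _.
rewrite summxE; apply: eq_bigr => g _.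
rewrite -(mul_delta_mx (0 : 'I_1)) mulmxA -colE -mulmxA -rowE.
by rewrite mxE big_ord1 !mxE.
Qed.

Lemma repr_dot_neq0_rsim : mx_irreducible rU -> mx_irreducible rV ->
  repr_dot rU rV != 0 -> mx_rsim rU rV.
Proof.
move=> irrU irrV nz.
have [[i j] /= nzij|all0] := pickP (fun ij : 'I_m * 'I_n => repr_avg (delta_mx ij.1 ij.2) != 0).
  exact: mx_Schur_rsim irrU irrV (repr_avg_hom _) nzij.
case/negP: nz; rewrite -(mulrI_eq0 _ (@mulfI _ #|G|%:R _)) ?pnatr_eq0 -?lt0n ?cardG_gt0 //.
rewrite repr_dot_avg big1 // => i _; rewrite big1 // => j _.
by have /negbFE/eqP/= -> := all0 (i, j); rewrite mxE.
Qed.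

End Average.

(** Over an algebraically closed field the average of E_ij is a scalar matrix, and its trace
    determines the scalar. *)
Lemma repr_dot_irr n (rU : reprG n) : mx_irreducible rU -> repr_dot rU rU = 1.
Proof.
move=> irrU; have n_gt0 : (0 < n)%N by case/mx_irrP: irrU.
have abU : mx_absolutely_irreducible rU by apply: group_closure_closed_field.
have nzn : n%:R != 0 :> C by rewrite pnatr_eq0 -lt0n.
have nzG : #|G|%:R != 0 :> C by rewrite pnatr_eq0 -lt0n cardG_gt0.
have avgE i j : repr_avg rU rU (delta_mx i j) = (#|G|%:R / n%:R * (i == j)%:R)%:M.
  have /is_scalar_mxP[a Da] : is_scalar_mx (repr_avg rU rU (delta_mx i j)).
    apply: (mx_abs_irr_cent_scalar abU); apply/centgmxP => x Gx.
    by rewrite repr_avg_hom.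
  have : \tr (repr_avg rU rU (delta_mx i j)) = #|G|%:R * (i == j)%:R.
    rewrite linear_sum /= (eq_bigr (fun=> (i == j)%:R)) => [|g Gg].
      by rewrite sumr_const mulr_natl.
    rewrite mxtrace_mulC mulmxA -repr_mxM ?groupV // mulgV repr_mx1 mul1mx.
    rewrite /mxtrace (bigD1 i) //= big1 ?addr0 => [|l li]; rewrite mxE ?eqxx //.
    by rewrite (negPf li).
  rewrite Da mxtrace_scalar -[X in X = _]mulr_natl => Ea.
  by congr _%:M; apply: (mulfI nzn); rewrite Ea mulrA [n%:R * _]mulrC divfK.
apply: (mulfI nzG); rewrite repr_dot_avg mulr1.
rewrite (eq_bigr (fun=> #|G|%:R / n%:R)) => [|i _].
  by rewrite sumr_const card_ord -[LHS]mulr_natr divfK.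
rewrite (bigD1 i) //= big1 ?addr0 => [|j ji]; rewrite avgE !mxE ?eqxx ?mulr1 //.
by rewrite eq_sym (negPf ji) mulr0 mul0rn.
Qed.

Lemma repr_dot_rsim m n (rU : reprG m) (rV : reprG n) :
  mx_irreducible rU -> mx_rsim rU rV -> repr_dot rU rV = 1.
Proof.
move=> irrU /mxtrace_rsim trUV.
by rewrite -(repr_dot_irr irrU); apply: eq_repr_dotr => g Gg; rewrite trUV.
Qed.

Lemma repr_dot_irr_ge0 m n (rU : reprG m) (rV : reprG n) :
  mx_irreducible rU -> mx_irreducible rV -> 0 <= repr_dot rU rV.
Proof.
move=> irrU irrV; have [->//|/repr_dot_neq0_rsim sim] := eqVneq (repr_dot rU rV) 0.
by rewrite repr_dot_rsim ?ler01 //; apply: sim.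
Qed.

Lemma pchar'_group : [pchar C]^'.-group G.
Proof. by rewrite /pgroup pcharf'_nat pnatr_eq0 -lt0n cardG_gt0. Qed.

Lemma repr_semisimple n (rV : reprG n) :
  exists (I : finType) (U : I -> 'M[C]_n) (modU : forall i, mxmodule rV (U i)),
    (forall i, mx_irreducible (submod_repr (modU i))) /\
    {in G, forall g, \tr (rV g) = \sum_i \tr (submod_repr (modU i) g)}.
Proof.
have [I U /= simU defU dxU] := dec_mx_reducible_semisimple (mxmodule1 rV)
   (mx_Maschke_pchar rV pchar'_group).
exists I, U, (fun i => mxsimple_module (simU i)); split=> [i|g Gg].
  exact/submod_mx_irr.
rewrite (mxtrace_dsum_mod _ (mxmodule1 rV) defU dxU Gg).
by rewrite (mxtrace_rsim (rsim_submod1 _ _)).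
Qed.

Lemma repr_dot_sum n (rV : reprG n) m (rU : reprG m) (I : finType) (W : I -> rep) :
  {in G, forall g, \tr (rV g) = \sum_i \tr (W i g)} ->
  repr_dot rU rV = \sum_i repr_dot rU (W i).
Proof.
move=> trV; rewrite (@repr_dot_lincomb _ (index_enum I) predT _ _ _ _ (fun=> 1) W).
  by apply: eq_bigr => i _; rewrite mul1r.
by move=> g /trV ->; apply: eq_bigr => i _; rewrite mul1r.
Qed.

(** Induction on the dimension: a constituent of rU also occurs in rV, and the Maschke complements
    of the two copies again have equal traces. *)
Lemma eq_mxtrace_rsim m n (rU : reprG m) (rV : reprG n) :
  {in G, forall g, \tr (rU g) = \tr (rV g)} -> mx_rsim rU rV.
Proof.
have [k] := ubnP m; elim: k m n rU rV => // k IHk m n rU rV lt_mk eqUV.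
have def_n : n = m.
  by apply/eqP; rewrite -(eqr_nat C) -!mxtrace1 -(repr_mx1 rU) -(repr_mx1 rV) eqUV.
case: n / {def_n}(esym def_n) rV eqUV => rV eqUV.
have [I [U [modU [irrU trU]]]] := repr_semisimple rU.
have [J [W [modW [irrW trW]]]] := repr_semisimple rV.
have [i0 _|noI] := pickP (xpredT : pred I); last first.
  have m0 : m = 0%N.
    apply/eqP; rewrite -(eqr_nat C) -mxtrace1 -(repr_mx1 rU) trU //.
    by rewrite big_pred0.
  exists 1%:M => // [|x _]; first by rewrite row_free_unit unitmx1.
  by apply/matrixP=> i; have := ltn_ord i; rewrite {2}m0.
pose S := Representation (submod_repr (modU i0)).
have irrS : mx_irreducible S := irrU i0.
pose WJ j := Representation (submod_repr (modW j)).
have dotV : repr_dot S rV = \sum_j repr_dot S (WJ j) by exact: repr_dot_sum.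
(* S pairs to 1 with itself and to a nonnegative number with every other constituent of rU, so the
   sum cannot vanish; a nonzero sum on the rV side then exhibits a constituent similar to S. *)
have : repr_dot S rV != 0.
  rewrite -(eq_repr_dotr S eqUV).
  rewrite (repr_dot_sum S (W := fun i => Representation (submod_repr (modU i)))) //.
  rewrite psumr_neq0 => [|i _]; last exact: repr_dot_irr_ge0 irrS (irrU i).
  by apply/hasP; exists i0; rewrite ?mem_index_enum //= repr_dot_irr ?ltr01.
rewrite dotV psumr_neq0 => [|j _]; last exact: repr_dot_irr_ge0 irrS (irrW j).
case/hasP=> j0 _ /= /lt0r_neq0 /(repr_dot_neq0_rsim irrS (irrW j0)) simSW.
have [T modT defT dxT] := mx_Maschke_pchar rU pchar'_group (modU i0) (submx1 _).
have [T' modT' defT' dxT'] := mx_Maschke_pchar rV pchar'_group (modW j0) (submx1 _).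
pose rT := Representation (submod_repr modT).
have simT : mx_rsim (submod_repr modT') rT.
  apply: mx_rsim_sym; apply: IHk => [|g Gg].
    rewrite -ltnS; apply: leq_trans lt_mk; rewrite ltnS -[X in (_ < X)%N](mxrank1 C) -defT (mxdirectP dxT) /=.
    by rewrite -[X in (X < _)%N]add0n ltn_add2r; case/mx_irrP: irrS.
  have := eqUV g Gg; rewrite -(mxtrace_submod1 (mxmodule1 rU) _ Gg) //.
  rewrite -(mxtrace_submod1 (mxmodule1 rV) _ Gg) //.
  rewrite -(mxtrace_dadd_mod (modU i0) modT _ defT dxT Gg).
  rewrite -(mxtrace_dadd_mod (modW j0) modT' _ defT' dxT' Gg).
  by rewrite -(mxtrace_rsim simSW) // => /addrI.
have rsim1 n' (r : reprG n') : mx_rsim r (submod_repr (mxmodule1 r)).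
  exact/mx_rsim_sym/rsim_submod1.
apply: mx_rsim_trans (rsim1 _ rU) _.
apply: mx_rsim_trans (mx_rsim_dadd (rU := S) (rV := rT) _ defT dxT _ _) _;
  try exact: mx_rsim_refl.
apply: mx_rsim_trans _ (mx_rsim_sym (rsim1 _ rV)); apply: mx_rsim_sym.
exact: mx_rsim_dadd defT' dxT' (mx_rsim_sym simSW) simT.
Qed.

(* The dimension count leaves no room for an irreducible constituent of rX    *)
(* that is missing from the list.                                             *)
Lemma mxtrace_of_mult (T : eqType) (r : seq T) (S : T -> rep) (a : T -> nat)
    n (rX : reprG n) :
  uniq r -> {in r, forall l, mx_irreducible (S l)} ->
  {in r &, forall l l', l != l' -> repr_dot (S l) (S l') = 0} ->
  {in r, forall l, repr_dot (S l) rX = (a l)%:R} ->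
  n = (\sum_(l <- r) a l * rdegree (S l))%N ->
  {in G, forall g, \tr (rX g) = \sum_(l <- r) (a l)%:R * \tr (S l g)}.
Proof.
move=> Ur irrS orthS multX dimX.
have [I [U [modU [irrU trU]]]] := repr_semisimple rX.
pose W i := Representation (submod_repr (modU i)).
have irrW i : mx_irreducible (W i) := irrU i.
(* [cov i] holds when the constituent [W i] is similar to some listed representation. *)
pose cov i := has (fun l => repr_dot (S l) (W i) != 0) r.
have sumW i g : g \in G ->
    \sum_(l <- r) repr_dot (S l) (W i) * \tr (S l g) = if cov i then \tr (W i g) else 0.
  move=> Gg; case: ifP => [/hasP[l rl nzl]|/hasPn no].
    have sim := repr_dot_neq0_rsim (irrS l rl) (irrW i) nzl.
    rewrite (bigD1_seq l) //= (repr_dot_rsim _ sim) ?mul1r; last exact: irrS.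
    rewrite -(mxtrace_rsim sim Gg) big1_seq ?addr0 // => l' /andP[l'l rl'].
    rewrite -(eq_repr_dotr _ (mxtrace_rsim sim)) orthS ?mul0r //.
  by rewrite big1_seq // => l /andP[_ /no /negbNE/eqP ->]; rewrite mul0r.
have sumX g : g \in G ->
    \sum_(l <- r) (a l)%:R * \tr (S l g) = \sum_i if cov i then \tr (W i g) else 0.
  move=> Gg; under [RHS]eq_bigr do rewrite -sumW //.
  rewrite exchange_big; apply: eq_big_seq => l rl /=.
  by rewrite -multX // (repr_dot_sum (S l) (W := W) trU) mulr_suml.
have degE (V : rep) : \tr (V 1%g) = (rdegree V)%:R by rewrite repr_mx1 mxtrace1.
have covT i : cov i.
  pose w j : C := (rdegree (W j))%:R.
  have /eqP : \sum_j w j = \sum_j if cov j then w j else 0.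
    transitivity (n%:R : C).
      rewrite -mxtrace1 -(repr_mx1 rX) trU //.
      by apply: eq_bigr => j _; rewrite /w -degE.
    rewrite [in LHS]dimX natr_sum.
    transitivity (\sum_(l <- r) (a l)%:R * \tr (S l 1%g)).
      by apply: eq_bigr => l _; rewrite degE natrM.
    by rewrite sumX //; apply: eq_bigr => j _; rewrite degE.
  (* An uncovered constituent would contribute its positive degree to a difference of dimensions
     that vanishes. *)
  apply: contraLR => ncov; rewrite -subr_eq0 -sumrB.
  rewrite psumr_neq0 => [|j _]; last by case: ifP; rewrite ?subrr ?subr0 ?ler0n.
  apply/hasP; exists i; rewrite ?mem_index_enum // (negPf ncov) subr0 ltr0n.
  by case/mx_irrP: (irrW i).
move=> g Gg; rewrite sumX // trU //.
by apply: eq_bigr => i _; rewrite covT.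
Qed.

End ReprDot.

(** * Traces on the quantum double *)

Lemma mxtrace_tens (R : comPzRingType) m n (A : 'M[R]_m) (B : 'M[R]_n) :
  \tr (A *t B) = \tr A * \tr B.
Proof.
rewrite /mxtrace mulr_suml; under [RHS]eq_bigr do rewrite mulr_sumr.
rewrite pair_bigA (reindex (@mxtens_index m n)) /=.
  by apply: eq_bigr => -[i j] _; rewrite tensmxE.
by apply: onW_bij; exists (@mxtens_unindex m n);
  [exact: mxtens_indexK | exact: mxtens_unindexK].
Qed.

Section QDTrace.

Variables (C : numClosedFieldType) (gT : finGroupType) (G : {group gT}).
Local Notation rep := (representation C G).

Lemma mxtrace_qd_comp (U : qdobj C G) z (Zz : z \in 'Z(G)) g :
  \tr (qd_comp U Zz g) = \tr (qd_act U g *m qd_proj U z).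
Proof. by rewrite /= /qd_comp_mx -mulmxA mxtrace_mulC -mulmxA mulmx_base. Qed.

Lemma mxtrace_qd_tens (U V : qdobj C G) g z : z \in G ->
  \tr (qd_act (qd_tens U V) g *m qd_proj (qd_tens U V) z)
  = \sum_(y in G) \tr (qd_act U g *m qd_proj U y)
                  * \tr (qd_act V g *m qd_proj V (y^-1 * z)%g).
Proof.
move=> Gz /=; rewrite qd_tens_projE // mulmx_sumr linear_sum /=.
by apply: eq_bigr => y _; rewrite tensmx_mul mxtrace_tens.
Qed.

Section Simple.

Variables (x : gT) (Gx : x \in G) (d : nat).
Variable rho : mx_representation C 'C_G[x] d.

Local Notation a_ i := (@qd_rep _ G x i).

(** Only the diagonal blocks of L_g contribute, that is, the representatives whose coset is fixed by
    g. *)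
Lemma mxtrace_qd_simple g y :
  \tr (qd_act (qd_simple Gx rho) g *m qd_proj (qd_simple Gx rho) y)
  = \sum_(i | (a_ i * x * (a_ i)^-1 == y)%g && (g ^ a_ i \in 'C_G[x])%g)
      \tr (rho (g ^ a_ i)%g).
Proof.
rewrite /= /qd_simple_proj mulmx_sumr linear_sum /=.
rewrite [in RHS]big_mkcondr; apply: eq_bigr => i _.
rewrite /qd_simple_act mulmx_suml linear_sum /= (bigD1 i) //= [X in _ + X]big1.
  rewrite addr0 mulmx_suml linear_sum /=.
  have term j : \tr ((delta_mx j i *t rho ((a_ j)^-1 * g * a_ i)%g) *m (delta_mx i i *t 1%:M))
      = (j == i)%:R * \tr (rho ((a_ j)^-1 * g * a_ i)%g).
    rewrite tensmx_mul mul_delta_mx mulmx1 mxtrace_tens; congr (_ * _).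
    rewrite /mxtrace (bigD1 i) //= big1 ?addr0 => [|l li].
      by rewrite mxE eqxx andbT eq_sym.
    by rewrite mxE (negPf li) andbF.
  rewrite big_mkcond (bigD1 i) //= term eqxx mul1r big1 ?addr0.
    by rewrite conjgE mulgA.
  by move=> j ji; rewrite term (negPf ji) mul0r if_same.
move=> l li; rewrite mulmx_suml linear_sum big1 // => j _ /=.
by rewrite tensmx_mul mul_delta_mx_0 // tens0mx linear0.
Qed.

(** This removes the choice of coset representatives: a differs from the representative of its coset
    by an element of the centraliser, under which membership and the trace of rho are invariant. *)
Lemma mxtrace_qd_simple_conj g a : g \in G -> a \in G ->
  \tr (qd_act (qd_simple Gx rho) g *m qd_proj (qd_simple Gx rho) (a * x * a^-1)%g)
  = if (g ^ a \in 'C_G[x])%g then \tr (rho (g ^ a)%g) else 0.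
Proof.
move=> Gg Ga; rewrite mxtrace_qd_simple.
have [i ia] := qd_rep_ex x Ga.
have conjE j : (a_ j * x * (a_ j)^-1 == a * x * a^-1)%g = (j == i).
  apply/eqP/eqP => [E|->].
    apply: qd_rep_uniq ia; rewrite inE groupM ?groupV ?qd_rep_in //=.
    have xb : (x * ((a_ j)^-1 * a) = (a_ j)^-1 * a * x)%g.
      by apply: (mulgI (a_ j)); apply: (mulIg a^-1%g); rewrite !mulgA mulgK mulgV mul1g.
    by apply/cent1P; rewrite /commute xb.
  have /setIP[_ /cent1P xb] := ia.
  have {}xb : (x * ((a_ i)^-1 * a) = (a_ i)^-1 * a * x)%g by rewrite xb.
  apply: (mulgI (a_ i)^-1%g); apply: (mulIg a); rewrite !mulgA mulVg mul1g mulgKV.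
  by rewrite !mulgA in xb; exact: xb.
rewrite (eq_bigl (fun j => (j == i) && (g ^ a_ i \in 'C_G[x])%g)) => [|j]; last first.
  by rewrite conjE; case: eqP => [->|].
rewrite big_mkcondr big_pred1_eq.
set b := ((a_ i)^-1 * a)%g in ia.
have -> : (g ^ a = (g ^ a_ i) ^ b)%g by rewrite -conjgM mulKVg.
rewrite (groupJr _ ia); move: b (g ^ a_ i)%g ia => {a Ga conjE} b t Cb; case: ifP => // Ct.
by rewrite conjgE !repr_mxM ?groupM ?groupV // [RHS]mxtrace_mulC repr_mxK.
Qed.

Lemma mxtrace_qd_simple_out g y : y \notin [set (a * x * a^-1)%g | a in G] ->
  \tr (qd_act (qd_simple Gx rho) g *m qd_proj (qd_simple Gx rho) y) = 0.
Proof.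
move=> ny; rewrite mxtrace_qd_simple big_pred0 // => i; apply/negbTE.
apply: contra ny => /andP[/eqP <- _]; apply: imset_f; exact: qd_rep_in.
Qed.

End Simple.

(** Orbit-stabiliser: the fibres of a |-> a x a^-1 over the class of x are left cosets of the
    centraliser. *)
Lemma sum_class_stab x (F : gT -> C) : x \in G ->
  (forall y, y \in G -> y \notin [set (a * x * a^-1)%g | a in G] -> F y = 0) ->
  \sum_(y in G) F y = #|'C_G[x]|%:R^-1 * \sum_(a in G) F (a * x * a^-1)%g.
Proof.
move=> Gx F0.
have nzC : #|'C_G[x]|%:R != 0 :> C by rewrite pnatr_eq0 -lt0n cardG_gt0.
apply: (mulfI nzC); rewrite mulVKf //.
rewrite [RHS](partition_big (fun a => (a * x * a^-1)%g) (mem G)) /=; last first.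
  by move=> a Ga; rewrite !groupM ?groupV.
rewrite mulr_sumr; apply: eq_bigr => y Gy.
rewrite [RHS](eq_bigr (fun=> F y)) => [|a /andP[_ /eqP->]//].
rewrite sumr_const -[RHS]mulr_natl.
have [/imsetP[b Gb Dy]|/(F0 y Gy) ->] := boolP (y \in [set (a * x * a^-1)%g | a in G]);
  last by rewrite !mulr0.
congr (_%:R * _); rewrite -(card_lcoset _ b); apply: eq_card => a.
transitivity ((a \in G) && ((a * x * a^-1)%g == y)) => //.
rewrite mem_lcoset in_setI groupMl ?groupV //; case: (a \in G) => //=.
apply/cent1P/eqP => [xb|E].
  have {}xb : (b^-1 * a * x = x * (b^-1 * a))%g by rewrite xb.
  by rewrite Dy; apply: (mulgI b^-1%g); apply: (mulIg a); rewrite !mulgA mulVg mul1g mulgKV xb mulgA.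
have xb : (b^-1 * a * x = x * (b^-1 * a))%g.
  by apply: (mulgI b); apply: (mulIg a^-1%g); rewrite !mulgA mulgV mul1g mulgK E.
by rewrite /commute xb.
Qed.

(* The fibre of the product over z is a single orbit, with stabiliser the     *)
(* centraliser of x1.                                                         *)
Lemma mxtrace_qd_simple_tens x1 x2 z n (Gx1 : x1 \in G) (Gx2 : x2 \in G)
    (Zz : z \in 'Z(G)) d1 d2
    (rho1 : mx_representation C 'C_G[x1] d1) (rho2 : mx_representation C 'C_G[x2] d2) g :
  n \in G -> (x1^-1 * z = n * x2 * n^-1)%g -> g \in G ->
  \tr (qd_comp (qd_tens (qd_simple Gx1 rho1) (qd_simple Gx2 rho2)) Zz g)
  = #|'C_G[x1]|%:R^-1 * \sum_(a in G) if (g ^ a \in 'C_G[x1])%g then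
       \tr (rho1 (g ^ a)%g) * \tr (rho2 (g ^ (a * n))%g) else 0.
Proof.
move=> Gn x12 Gg; have /centerP[Gz cGz] := Zz.
rewrite mxtrace_qd_comp mxtrace_qd_tens // (sum_class_stab Gx1) => [|y Gy ny]; last first.
  by rewrite mxtrace_qd_simple_out ?mul0r.
congr (_ * _); apply: eq_bigr => a Ga.
have -> : ((a * x1 * a^-1)^-1 * z = (a * n) * x2 * (a * n)^-1)%g.
  rewrite !invMg invgK; transitivity (a * (x1^-1 * z) * a^-1)%g.
    by rewrite -!mulgA (cGz a^-1%g) ?groupV.
  by rewrite x12 !mulgA.
have Gan : (a * n)%g \in G by rewrite groupM.
rewrite (mxtrace_qd_simple_conj _ _ Gg Ga) (mxtrace_qd_simple_conj _ _ Gg Gan).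
(* As z is central, x1 and x1^-1 z have the same centraliser, and n conjugates it to that of x2. *)
suff -> : ((g ^ (a * n)) \in 'C_G[x2])%g = (g ^ a \in 'C_G[x1])%g.
  by case: ifP => //; rewrite mul0r.
have Dx2 : (x2 = (x1^-1 * z) ^ n)%g by rewrite conjgE x12 !mulgA mulVg mul1g mulgKV.
have Gga : (g ^ a)%g \in G by rewrite groupJ.
have czga : commute (g ^ a)%g z by rewrite /commute cGz.
rewrite conjgM Dx2 cent1J !in_setI groupJ // Gga memJ_conjg /=.
apply/cent1P/cent1P => [xg|xg]; last by apply: commuteM czga; apply: commuteV.
have -> : (x1 = z * (x1^-1 * z)^-1)%g by rewrite invMg invgK mulKVg.
by apply: commuteM czga _; apply: commuteV.
Qed.

End QDTrace.

(** * Frobenius reciprocity *)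

Section Induced.

Variables (C : numClosedFieldType) (gT : finGroupType) (G H : {group gT}).

(** The hypothesis on rX is the formula for the character induced from psi. After the substitution t
    = g^a, every a in G contributes the same sum over H. *)
Lemma repr_dot_ind m n (rU : mx_representation C G m) (rX : mx_representation C G n)
    (psi : gT -> C) : H \subset G ->
  {in G, forall g, \tr (rX g) =
    #|H|%:R^-1 * \sum_(a in G) if (g ^ a \in H)%g then psi (g ^ a)%g else 0} ->
  repr_dot rU rX = #|H|%:R^-1 * \sum_(t in H) \tr (rU t^-1%g) * psi t.
Proof.
move=> sHG trX; rewrite /repr_dot.
have nzG : #|G|%:R != 0 :> C by rewrite pnatr_eq0 -lt0n cardG_gt0.
apply: (mulfI nzG); rewrite mulVKf // mulrCA.
under eq_bigr => g Gg do rewrite trX // mulrCA mulr_sumr.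
rewrite -mulr_sumr exchange_big /=; congr (_ * _).
rewrite (eq_bigr (fun=> \sum_(t in H) \tr (rU t^-1%g) * psi t)) => [|a Ga].
  by rewrite sumr_const mulr_natl.
rewrite (reindex_inj (conjg_inj a^-1%g)) /=.
transitivity (\sum_(t in G | t \in H) \tr (rU t^-1%g) * psi t); last first.
  by apply: eq_bigl => t; case Ht: (t \in H); rewrite ?andbF // (subsetP sHG).
rewrite big_mkcondr; apply: eq_big => [t|t]; rewrite groupJr ?groupV // => Gt.
rewrite conjgKV -conjVg; case: ifP => // _; last by rewrite mulr0.
congr (_ * _); rewrite conjgE invgK !repr_mxM ?groupM ?groupV //.
by rewrite [LHS]mxtrace_mulC repr_mxKV.
Qed.

End Induced.

(** * The split torus of SL(2, q) *)

Section Mx2.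

Variable F : finFieldType.
Implicit Types x y z t : F.

Lemma mul_mx2 x y z t x' y' z' t' :
  mx2 x y z t *m mx2 x' y' z' t'
  = mx2 (x * x' + y * z') (x * y' + y * t') (z * x' + t * z') (z * y' + t * t').
Proof.
by apply/matrixP => i j; rewrite !mxE !big_ord_recl big_ord0 addr0 !mxE /=; do 2![case: ifP => _].
Qed.

Lemma mx2_eta (M : 'M[F]_2) : M = mx2 (M 0 0) (M 0 1) (M 1 0) (M 1 1).
Proof.
apply/matrixP => i j; rewrite !mxE.
by case: i j => [[|[|//]] lti] [[|[|//]] ltj] /=; congr (M _ _); apply: val_inj.
Qed.

Lemma mx2_inj x y z t x' y' z' t' :
  mx2 x y z t = mx2 x' y' z' t' -> [/\ x = x', y = y', z = z' & t = t'].
Proof.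
move=> /matrixP E; have := E 1 1; have := E 1 0; have := E 0 1; have := E 0 0.
by rewrite !mxE.
Qed.

Lemma mx2_scalar x : x%:M = mx2 x 0 0 x.
Proof.
apply/matrixP => i j; rewrite !mxE.
by case: i j => [[|[|//]] lti] [[|[|//]] ltj].
Qed.

Lemma GL2_ofE x y z t : x * t - y * z != 0 -> GLval (GL2_of (mx2 x y z t)) = mx2 x y z t.
Proof. by move=> nz; rewrite GL2_ofK // unitmxE det_mx2 unitfE. Qed.

(** The fibres of the determinant on GL(2) over the nonzero scalars are cosets of SL(2). *)
Lemma card_SL2 : #|SL2 F| = (#|F| * #|F|.-1 * #|F|.+1)%N.
Proof.
have F1_gt0 : (0 < #|F|.-1)%N by rewrite -subn1 subn_gt0 finNzRing_gt1.
suff cardGL : #|'GL_2[F]| = (#|F|.-1 * #|SL2 F|)%N.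
  apply/eqP; rewrite -(eqn_pmul2l F1_gt0) -cardGL card_GL_2 -mulnn mulnCA !mulnA.
  by [].
rewrite -sum1_card (partition_big (fun g : {'GL_2[F]} => \det (GLval g)) [pred x | x != 0]) /=.
  rewrite (eq_bigr (fun=> #|SL2 F|)) => [|x nzx].
    by rewrite sum_nat_const -(cardC1 (0 : F)).
  pose g0 : {'GL_2[F]} := GL2_of (mx2 x 0 0 1).
  have det_g0 : \det (GLval g0) = x.
    by rewrite GL2_ofE ?det_mx2 mulr1 mulr0 subr0.
  rewrite sum1_card -(card_lcoset _ g0); apply: eq_card => g.
  rewrite mem_lcoset !inE unfold_in /= inE /=.
  rewrite -[X in \det X == 1]/(invmx (GLval g0) *m GLval g) det_mulmx det_inv det_g0.
  by rewrite -[RHS](inj_eq (mulfI nzx)) mulVKf // mulr1.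
by move=> g _; have := GL_det g.
Qed.

End Mx2.

Lemma sum_cycle (R : nmodType) (gT : finGroupType) (x : gT) (f : gT -> R) :
  \sum_(t in <[x]>%g) f t = \sum_(i < #[x]%g) f (x ^+ i)%g.
Proof.
have -> : <[x]>%g = [set (x ^+ i)%g | i : 'I_(#[x]%g)].
  apply/setP => t; apply/idP/imsetP => [t_x|[i _ ->]]; last exact: mem_cycle.
  by have [i lt_i ->] := cyclePmin t_x; exists (Ordinal lt_i).
rewrite big_imset //= => i j _ _ /eqP; rewrite eq_expg_mod_order.
by rewrite !modn_small // => /eqP /val_inj.
Qed.

Section Torus.

Variables (F : finFieldType) (e : F).
Hypothesis prim_e : (#|F|.-1).-primitive_root e.

Local Notation a := (SL2_a e).
Local Notation N := (#|F|.-1).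

Lemma SL2_aXE i : GLval (a ^+ i)%g = mx2 (e ^+ i) 0 0 (e ^- i).
Proof.
have nze := prim_root_neq0 prim_e.
elim: i => [|i IHi]; first by rewrite expr0 invr1 -mx2_scalar.
rewrite expgS (GL_MxE a) IHi GL2_ofE ?mul_mx2 ?mulfV ?mul0r ?subr0 ?oner_eq0 //.
by rewrite !(mulr0, mul0r, addr0, add0r) exprS invfM.
Qed.

Lemma order_SL2_a : #[a]%g = N.
Proof.
apply/eqP; rewrite eqn_dvd order_dvdn; apply/andP; split.
  apply/eqP/val_inj; rewrite [LHS]SL2_aXE (prim_expr_order prim_e) invr1.
  by rewrite -mx2_scalar.
rewrite (prim_order_dvd prim_e); apply/eqP.
have := SL2_aXE #[a]%g; rewrite expg_order GL_1E -[1]/(1%:M) mx2_scalar.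
by case/mx2_inj.
Qed.

(** The condition says that the eigenvalues e^k and e^-k differ. A commuting matrix is then
    diagonal, and with determinant 1 it is a power of a. *)
Lemma cent_SL2_a k : ~~ (N %| k.*2)%N -> 'C_(SL2 F)[(a ^+ k)%g] = <[a]>%g.
Proof.
move=> nk; have nze := prim_root_neq0 prim_e.
apply/eqP; rewrite eqEsubset; apply/andP; split; last first.
  rewrite cycle_subG inE -[a in a \in SL2 _]expg1 SL2_a_in /=.
  by apply/cent1P; rewrite /commute -expgS -expgSr.
apply/subsetP => g /setIP[]; rewrite inE => /eqP detg /cent1P cg.
have {}cg : GLval (g * a ^+ k)%g = GLval (a ^+ k * g)%g by rewrite cg.
have nz2 : e ^+ k != e ^- k.
  apply: contra nk => /eqP E; rewrite (prim_order_dvd prim_e) -addnn exprD.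
  by rewrite [X in X * _]E mulVf // expf_neq0.
move: cg; rewrite (GL_MxE g) (GL_MxE (a ^+ k)%g) SL2_aXE.
have := detg; rewrite (mx2_eta (GLval g)) !mul_mx2 det_mx2.
set x := GLval g 0 0; set y := GLval g 0 1; set z := GLval g 1 0; set t := GLval g 1 1.
rewrite !(mulr0, mul0r, addr0, add0r) => det1 /mx2_inj[_ Ey Ez _].
have nze2 : e ^+ k - e ^- k != 0 by rewrite subr_eq0.
have y0 : y = 0.
  apply: (mulIf nze2); rewrite mul0r mulrBr Ey mulrC subrr //.
have z0 : z = 0.
  by apply: (mulIf nze2); rewrite mul0r mulrBr Ez mulrC subrr.
have xt : x * t = 1 by rewrite -det1 y0 mul0r subr0.
have nzx : x != 0 by apply: contra_eq_neq xt => ->; rewrite mul0r eq_sym oner_eq0.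
have xN : x ^+ N = 1.
  apply: (mulfI nzx); rewrite mulr1 -exprS prednK ?expf_card //.
  by rewrite (leq_trans _ (finNzRing_gt1 F)).
have [i Dx] := prim_rootP prim_e xN.
apply/cycleP; exists i; apply: val_inj; rewrite [RHS]SL2_aXE /= [LHS](mx2_eta (GLval g)) -/x -/y -/z -/t.
by rewrite y0 z0 -Dx; congr mx2; apply: (mulfI nzx); rewrite xt mulfV.
Qed.

Lemma SL2_aVE i : GLval (a ^- i)%g = mx2 (e ^- i) 0 0 (e ^+ i).
Proof.
have nze := prim_root_neq0 prim_e.
rewrite GL_VE SL2_aXE; apply: (mulrI (GL_unit (a ^+ i)%g)).
rewrite SL2_aXE mulrV -?[_ * _]/(_ *m _) ?mul_mx2.
  by rewrite !(mulr0, mul0r, addr0, add0r) mulfV ?mulVf ?expf_neq0 // -mx2_scalar.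
by have := GL_unit (a ^+ i)%g; rewrite SL2_aXE.
Qed.

Lemma SL2_weyl : exists2 w, w \in SL2 F &
  forall i, ((a ^+ i) ^ w = a ^- i /\ a ^- i = w * a ^+ i * w^-1)%g.
Proof.
pose w : {'GL_2[F]} := GL2_of (mx2 0 1 (-1) 0).
have wE : GLval w = mx2 0 1 (-1) 0.
  by rewrite GL2_ofE // mul0r mul1r opprK add0r oner_eq0.
exists w => [|i]; first by rewrite inE wE det_mx2 mul0r mul1r opprK add0r.
split.
  rewrite conjgE; apply: (mulgI w); rewrite mulKVg; apply: val_inj.
  rewrite [LHS](GL_MxE (a ^+ i)%g w) [RHS](GL_MxE w (a ^- i)%g) SL2_aXE SL2_aVE wE.
  by rewrite !mul_mx2 !(mulr0, mul0r, addr0, add0r, mulr1, mul1r, mulrN1, mulN1r).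
apply: (mulIg w); rewrite mulgKV; apply: val_inj.
rewrite [LHS](GL_MxE (a ^- i)%g w) [RHS](GL_MxE w (a ^+ i)%g) SL2_aXE SL2_aVE wE.
by rewrite !mul_mx2 !(mulr0, mul0r, addr0, add0r, mulr1, mul1r, mulrN1, mulN1r).
Qed.

Lemma SL2_aN i : (i <= N)%N -> (a ^- i = a ^+ (N - i))%g.
Proof.
move=> le_i; have nze := prim_root_neq0 prim_e.
have nz j : e ^+ j != 0 by rewrite expf_neq0.
have eN : e ^- i = e ^+ (N - i).
  by apply: (mulIf (nz i)); rewrite mulVf // -exprD subnK // (prim_expr_order prim_e).
by apply: val_inj; rewrite [LHS]SL2_aVE [RHS]SL2_aXE -eN invrK.
Qed.

(** The Weyl element conjugates a^i to its inverse. This removes the inverse from the Frobenius sum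
    over the torus. *)
Lemma mxtrace_SL2_aN (K : fieldType) m (rho : mx_representation K (SL2 F) m) i :
  \tr (rho (a ^- i)%g) = \tr (rho (a ^+ i)%g).
Proof.
have [w Gw wE] := SL2_weyl.
have -> : (a ^- i = w^-1 * a ^+ i * w)%g by have [<- _] := wE i; rewrite conjgE mulgA.
by rewrite !repr_mxM ?groupM ?groupV ?SL2_a_in // -mulmxA mxtrace_mulC repr_mxK.
Qed.

Lemma sum_cycle_SL2_a (R : nmodType) (f : {'GL_2[F]} -> R) :
  \sum_(t in <[a]>%g) f t = \sum_(i < N) f (a ^+ i)%g.
Proof.
by rewrite -order_SL2_a; apply: sum_cycle.
Qed.

Lemma SL2_eN1 h : N = h.*2 -> (a ^+ h)%g = SL2_e F true.
Proof.
move=> DN; apply: val_inj; rewrite [LHS]SL2_aXE [RHS]SL2_eE expr1 mx2_scalar.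
by rewrite (prim_half prim_e DN) invrN1.
Qed.

Lemma SL2_e1 : SL2_e F false = 1%g.
Proof. by apply: val_inj; rewrite [LHS]SL2_eE expr0. Qed.

End Torus.

Lemma primitive_root_generator (L : finFieldType) (c : {unit L}) :
  generator [set: {unit L}] c -> (#|L|.-1).-primitive_root (FinRing.uval c).
Proof.
rewrite /generator => /eqP gen_c.
have ord_c : #[c]%g = #|L|.-1 by rewrite orderE -gen_c card_finField_unit.
have L_gt0 : (0 < #|L|.-1)%N by rewrite -ord_c order_gt0.
have cN : FinRing.uval c ^+ #|L|.-1 = 1 by rewrite -ord_c -FinRing.val_unitX expg_order.
have [m prim_m m_dv] := prim_order_exists L_gt0 cN.
suff /eqP <- : m == #|L|.-1 by [].
rewrite eqn_dvd m_dv -ord_c order_dvdn; apply/eqP/val_inj.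
by rewrite FinRing.val_unitX (prim_expr_order prim_m).
Qed.

(** * Complex roots of unity *)

Section Zeta.

Variable R : realType.
Implicit Type m j : nat.

Lemma zetaX m j : zeta R m ^+ j =
  Complex (cos (2 * pi * j%:R / m%:R)) (sin (2 * pi * j%:R / m%:R)).
Proof.
elim: j => [|j IHj]; first by rewrite mulr0 mul0r cos0 sin0.
have -> : 2 * pi * j.+1%:R / m%:R = 2 * pi / m%:R + 2 * pi * j%:R / m%:R :> R.
  by rewrite -[j.+1%:R]natr1; ring.
rewrite exprS IHj cosD sinD.
by congr Complex; rewrite addrC.
Qed.

(** If the order k were less than m, then cos(2 pi k / m) = 1 would force sin(pi k / m) = 0 by the
    double-angle formula, although 0 < pi k / m < pi. *)
Lemma zeta_primitive m : (0 < m)%N -> m.-primitive_root (zeta R m).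
Proof.
move=> m0; have nzm : m%:R != 0 :> R by rewrite pnatr_eq0 -lt0n.
have zm : zeta R m ^+ m = 1.
  by rewrite zetaX mulfK // mulrC -[pi * 2]/(pi * 2) mulr_natr cos2pi sin2pi.
have [k prim_k k_dv] := prim_order_exists m0 zm.
suff /eqP km : k == m by move: prim_k; rewrite {1}km.
have k_gt0 := prim_order_gt0 prim_k; have km := dvdn_leq m0 k_dv.
rewrite eqn_leq km leqNgt; apply/negP => lt_km.
have /eqP := prim_expr_order prim_k; rewrite zetaX eq_complex /= => /andP[/eqP cos1 _].
pose x : R := pi * k%:R / m%:R.
have : 0 < sin x.
  apply: sin_gt0_pi; rewrite divr_gt0 ?mulr_gt0 ?pi_gt0 ?ltr0n //=.
  by rewrite ltr_pdivrMr ?ltr0n // ltr_pM2l ?pi_gt0 // ltr_nat.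
have -> : sin x = 0; last by rewrite ltxx.
have /eqP : sin x ^+ 2 = 0; last by rewrite sqrf_eq0 => /eqP.
rewrite sin2cos2; have := cos_mulr2n x.
have -> : x *+ 2 = 2 * pi * k%:R / m%:R by rewrite /x -mulr_natl; ring.
by rewrite cos1 => ?; lra.
Qed.

End Zeta.

(** * Irreducible representations of SL(2, q) *)

Local Open Scope complex_scope.

(** Labels let the eight families of irreducibles be treated by one list and one sum; the coding
    into pairs of naturals supplies decidable equality. *)
Inductive SL2_label :=
  Lab1 | LabV | LabW of nat | LabX of nat | LabW' | LabW'' | LabX' | LabX''.

Definition SL2_label_code l : nat * nat :=
  match l with
  | Lab1 => (0, 0) | LabV => (1, 0) | LabW s => (2, s) | LabX f => (3, f)
  | LabW' => (4, 0) | LabW'' => (5, 0) | LabX' => (6, 0) | LabX'' => (7, 0)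
  end%N.

Definition SL2_label_decode c :=
  match c with
  | (0, _) => Lab1 | (1, _) => LabV | (2, s) => LabW s | (3, f) => LabX f
  | (4, _) => LabW' | (5, _) => LabW'' | (6, _) => LabX' | _ => LabX''
  end%N.

Lemma SL2_label_codeK : cancel SL2_label_code SL2_label_decode.
Proof. by case. Qed.

HB.instance Definition _ := Equality.copy SL2_label (can_type SL2_label_codeK).

Definition SL2_labels h : seq SL2_label :=
  [:: Lab1; LabV] ++ [seq LabW s | s <- index_iota 1 (2 * h)]
  ++ [seq LabX f | f <- index_iota 1 (2 * h).+1] ++ [:: LabW'; LabW''; LabX'; LabX''].

Definition label_range h l :=
  match l with
  | LabW s => (1 <= s <= 2 * h - 1)%N | LabX f => (1 <= f <= 2 * h)%N | _ => true
  end.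

Definition label_deg h l :=
  match l with
  | Lab1 => 1 | LabV => 4 * h + 1 | LabW _ => 4 * h + 2 | LabX _ => 4 * h
  | LabW' | LabW'' => 2 * h + 1 | LabX' | LabX'' => 2 * h
  end%N.

Definition label_mult (N : SL2_mult) l :=
  match l with
  | Lab1 => mult_1 N | LabV => mult_V N | LabW s => mult_W N s | LabX f => mult_X N f
  | LabW' => mult_W' N | LabW'' => mult_W'' N | LabX' => mult_X' N | LabX'' => mult_X'' N
  end.

(** Both parities of d are merged: b is the parity of d, and [odd s == b] says that s has the same
    parity. *)
Definition expected_mult (h : nat) (d : int) : SL2_mult :=
  let b := odd `|d| in
  SL2Mult (d == 0) (if b then 0 else 2 + (d == 0%R))%N
    (fun s => 2 * (odd s == b) + (`|d|%N == s))%N (fun f => 2 * (odd f == b))%N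
    (if b then 0 else 1 + (`|d| == 2 * h))%N (if b then 0 else 1 + (`|d| == 2 * h))%N b b.

Lemma notin_map_LabW r l : ~~ (if l is LabW _ then true else false) ->
  (l \in [seq LabW s | s <- r]) = false.
Proof. by move=> nl; apply/negP => /mapP[s _ Dl]; rewrite Dl in nl. Qed.

Lemma notin_map_LabX r l : ~~ (if l is LabX _ then true else false) ->
  (l \in [seq LabX s | s <- r]) = false.
Proof. by move=> nl; apply/negP => /mapP[s _ Dl]; rewrite Dl in nl. Qed.

Lemma mem_SL2_labels h l : (0 < h)%N -> (l \in SL2_labels h) = label_range h l.
Proof.
move=> h_gt0; rewrite !mem_cat.
have memW s : (LabW s \in [seq LabW s | s <- index_iota 1 (2 * h)]) = (1 <= s <= 2 * h - 1)%N.
  by rewrite mem_map ?mem_index_iota; [lia | move=> ? ? []].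
have memX s : (LabX s \in [seq LabX s | s <- index_iota 1 (2 * h).+1]) = (1 <= s <= 2 * h)%N.
  by rewrite mem_map ?mem_index_iota; [lia | move=> ? ? []].
by case: l => [||s|f||||] //=; rewrite ?memW ?memX ?notin_map_LabX ?notin_map_LabW // orbF.
Qed.

Lemma uniq_SL2_labels h : uniq (SL2_labels h).
Proof.
rewrite !cat_uniq !map_inj_uniq ?iota_uniq; try by move=> ? ? [].
have hasF (p : pred nat) r : (forall x, p x = false) -> has p r = false.
  by move=> pF; apply/negP => /hasP[x _]; rewrite pF.
rewrite !has_cat !has_map /= !hasF ?notin_map_LabX ?notin_map_LabW // => f.
by rewrite /= notin_map_LabW.
Qed.

Lemma big_SL2_labels (V : Type) (idx : V) (op : Monoid.law idx) h (f : SL2_label -> V) :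
  \big[op/idx]_(l <- SL2_labels h) f l
  = op (op (op (op (op (op (op (f Lab1) (f LabV)) (\big[op/idx]_(1 <= s < 2 * h) f (LabW s)))
    (\big[op/idx]_(1 <= s < (2 * h).+1) f (LabX s))) (f LabW')) (f LabW'')) (f LabX'))
    (f LabX'').
Proof.
by rewrite !big_cat !big_cons !big_nil !big_map !Monoid.mulm1 !Monoid.mulmA.
Qed.

Lemma sum_odd_eq b h : (0 < h)%N ->
  (\sum_(1 <= s < (2 * h)) (odd s == b) = h - ~~ b)%N.
Proof.
case: h => // h _; elim: h => [|h IHh]; first by rewrite muln1 big_nat1; case: b.
have -> : (2 * h.+2 = (2 * h.+1).+2)%N by lia.
have m_gt0 : (0 < 2 * h.+1)%N by [].
have odd_m : odd (2 * h.+1) = false by rewrite oddM.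
move: (2 * h.+1)%N m_gt0 odd_m IHh => m m_gt0 odd_m IHh.
by rewrite big_nat_recr // big_nat_recr //= IHh odd_m /=; case: b {IHh}; lia.
Qed.

(** The terms depending on |d| beyond its parity always add 4h + 2: through 1 and V if d = 0,
    through W_|d| in between, through W' and W'' if |d| = 2h. The remaining terms depend on the
    parity alone. *)
Lemma sum_label_deg h d : (0 < h)%N -> (`|d| <= 2 * h)%N ->
  (\sum_(l <- SL2_labels h) label_mult (expected_mult h d) l * label_deg h l
   = (4 * h + 1) * (4 * h + 2))%N.
Proof.
move=> h_gt0 d_le; rewrite big_SL2_labels /= -!big_distrl -!big_distrr /=.
rewrite big_split /= -!big_distrr /= big_nat_recr ?sum_odd_eq /=; try lia.
have -> : (\sum_(1 <= s < 2 * h) (`|d|%N == s) = (1 <= `|d|%N < 2 * h))%N.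
  rewrite -mem_index_iota -(count_uniq_mem _ (iota_uniq _ _)) -sum1_count [RHS]big_mkcond.
  by apply: eq_bigr => s _; rewrite /= eq_sym; case: eqP.
have -> : (d == 0) = (`|d| == 0)%N by rewrite absz_eq0.
move: `|d|%N d_le => m m_le; rewrite oddM /=.
case odd_m: (odd m) => /=.
  have [m0 m2h] : (1 <= m)%N /\ (m < 2 * h)%N by move: odd_m; lia.
  by rewrite m0 m2h /=; nia.
case: (posnP m) => [->|m0]; first by rewrite /=; nia.
by rewrite /=; case: ltngtP m_le => //= _ _; nia.
Qed.

Section Family.

Variables (R : realType) (F : finFieldType) (h : nat) (e : F) (c : {'GL_2[F]}).
Variable I : SL2_family R F.
Local Notation C := R[i].
Local Notation G := (SL2 F).

Definition label_rep l : representation C G :=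
  match l with
  | Lab1 => irr_1 I | LabV => irr_V I | LabW s => irr_W I s | LabX f => irr_X I f
  | LabW' => irr_W' I | LabW'' => irr_W'' I | LabX' => irr_X' I | LabX'' => irr_X'' I
  end.

Lemma mxtrace_SL2_sum N g :
  \tr (SL2_sum h I N g) = \sum_(l <- SL2_labels h) (label_mult N l)%:R * \tr (label_rep l g).
Proof.
rewrite big_SL2_labels /SL2_sum !mxtrace_dadd !mxtrace_muln !mxtrace_dsum.
by congr (_ + _ + _ + _ + _ + _ + _); apply: eq_bigr => s _; rewrite mxtrace_muln.
Qed.

Hypotheses (h_gt0 : (0 < h)%N) (I_table : SL2_character_table h e c I).

Local Notation q := (4 * h + 1)%N.
Local Notation sgn mu := ((-1) ^+ mu : C).
Local Notation z_ m := (zeta R m).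

Definition label_val_e l (mu : bool) : C :=
  match l with
  | Lab1 => 1 | LabV => q%:R | LabW s => (q + 1)%:R * sgn mu ^+ s
  | LabX f => (q - 1)%:R * sgn mu ^+ f | LabW' | LabW'' => (2 * h + 1)%:R
  | LabX' | LabX'' => (2 * h)%:R * sgn mu
  end.

Definition label_val_a l k : C :=
  match l with
  | Lab1 | LabV => 1 | LabW s => z_ (q - 1) ^+ (s * k) + z_ (q - 1) ^- (s * k)
  | LabW' | LabW'' => (-1) ^+ k | _ => 0
  end.

Definition label_val_b l (mu eps : bool) : C :=
  match l with
  | Lab1 => 1 | LabV => 0 | LabW s => sgn mu ^+ s | LabX f => - sgn mu ^+ f
  | LabW' => s_pm R q eps | LabW'' => s_pm R q (~~ eps)
  | LabX' => - sgn mu * s_pm R q eps | LabX'' => - sgn mu * s_pm R q (~~ eps)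
  end.

Definition label_val_c l j : C :=
  match l with
  | Lab1 => 1 | LabV => -1 | LabX f => - z_ (q + 1) ^+ (f * j) - z_ (q + 1) ^- (f * j)
  | LabX' | LabX'' => (-1) ^+ (j + 1) | _ => 0
  end.

Lemma label_character l : label_range h l ->
  irr_with_character h e c (label_rep l)
    (label_val_e l) (label_val_a l) (label_val_b l) (label_val_c l).
Proof.
have [? [? [irrW [irrX [? [? [? ?]]]]]]] := I_table.
by case: l.
Qed.

Lemma label_irr l : label_range h l -> mx_irreducible (label_rep l).
Proof. by case/label_character. Qed.

Lemma label_degree l : label_range h l -> rdegree (label_rep l) = label_deg h l.
Proof.
case/label_character => _ [val_e _ _ _].
apply/eqP; rewrite -(eqr_nat C) -[X in X == _](mxtrace1 C) -(repr_mx1 (label_rep l)) -(SL2_e1 F).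
by rewrite val_e; case: l {val_e} => [||s|f||||] /=; rewrite ?expr0 ?expr1n ?mulr1 ?addnK -?addnA.
Qed.

Section Orthogonality.

Hypothesis c_SL2 : c \in G.

Lemma SL2_b_in (x : F) eps : SL2_b x eps \in G.
Proof.
have d1 : \det (mx2 1 (x ^+ eps) 0 1) = 1 by rewrite det_mx2 mulr0 subr0 mulr1.
by rewrite inE GL2_ofK ?d1 // unitmxE d1 unitr1.
Qed.

Lemma s_pm_neq eps : s_pm R q eps != s_pm R q (~~ eps).
Proof.
have nz2 : (2 : C) != 0 by rewrite pnatr_eq0.
have nzs : (Num.sqrt (q%:R : R))%:C != 0.
  by rewrite fmorph_eq0 sqrtr_eq0 -ltNge ltr0n; lia.
rewrite -subr_eq0 /s_pm -mulrBl mulf_neq0 ?invr_eq0 //.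
rewrite opprD addrACA subrr add0r.
case: eps; rewrite /= ?expr0 ?expr1 ?mulN1r ?mul1r ?opprK -?opprD ?oppr_eq0 -mulr2n.
  by rewrite mulrn_eq0.
by rewrite mulrn_eq0.
Qed.

(** Similar representations have equal degree, which leaves only pairs within W_s, within X_f, {W',
    W''} and {X', X''}; these are separated by the values at a, at c and at b respectively. *)
Lemma label_dot0 l l' : label_range h l -> label_range h l' -> l != l' ->
  repr_dot (label_rep l) (label_rep l') = 0.
Proof.
move=> rl rl' ll'; apply/eqP/negPn/negP => /repr_dot_neq0_rsim.
move=> /(_ (label_irr rl) (label_irr rl')) sim.
have := mxrank_rsim sim; rewrite !label_degree // => eq_deg.
have eq_tr := mxtrace_rsim sim.
have [_ [_ val_a val_b val_c]] := label_character rl.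
have [_ [_ val_a' val_b' val_c']] := label_character rl'.
have eq_a : label_val_a l 1 = label_val_a l' 1.
  rewrite -val_a ?eq_tr ?SL2_a_in ?val_a' //; lia.
have eq_b : label_val_b l false false = label_val_b l' false false.
  by rewrite -val_b eq_tr ?val_b' // groupM ?SL2_b_in // SL2_e1 group1.
have eq_c : label_val_c l 1 = label_val_c l' 1.
  by rewrite -val_c ?eq_tr ?val_c' ?groupX //; lia.
have zprim m : (0 < m)%N -> m.-primitive_root (z_ m) by exact: zeta_primitive.
move: rl rl' ll' eq_deg eq_a eq_b eq_c => {sim eq_tr val_a val_b val_c val_a' val_b' val_c'}.
case: l => [||s|f||||]; case: l' => [||s'|f'||||]; rewrite ?eqxx //=.
all: try by move=> *; lia.
- move=> s_r s'_r ss' _ eq_a _ _; case/eqP: ss'; congr LabW.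
  rewrite !muln1 in eq_a; have m_gt0 : (0 < q - 1)%N by lia.
  by apply: (prim_addV_inj (zprim _ m_gt0) _ _ _ _ eq_a); lia.
- move=> f_r f'_r ff' _ _ _ /eqP; rewrite -!opprD eqr_opp !muln1 => /eqP eq_c.
  case/eqP: ff'; congr LabX; have m_gt0 : (0 < q + 1)%N by lia.
  by apply: (prim_addV_inj (zprim _ m_gt0) _ _ _ _ eq_c); lia.
- by move=> _ _ _ _ _ /eqP; rewrite (negPf (s_pm_neq false)).
- by move=> _ _ _ _ _ /eqP; rewrite (negPf (s_pm_neq true)).
- by move=> _ _ _ _ _ /eqP; rewrite expr0 !mulN1r eqr_opp (negPf (s_pm_neq false)).
by move=> _ _ _ _ _ /eqP; rewrite expr0 !mulN1r eqr_opp (negPf (s_pm_neq true)).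
Qed.

End Orthogonality.

Hypotheses (cardF : #|F| = q) (prim_e : (4 * h).-primitive_root e).
Local Notation a := (SL2_a e).
Local Notation z := (z_ (q - 1)).

(** The table covers a^k only for k < 2h; this symmetry carries its formulas to the other half of
    the torus. *)
Lemma label_val_aN l i : (i <= 4 * h)%N -> label_val_a l (4 * h - i) = label_val_a l i.
Proof.
move=> le_i.
have prim_z : (4 * h).-primitive_root z by rewrite addnK; apply: zeta_primitive; lia.
have zN s : z ^+ (s * (4 * h - i)) = z ^- (s * i).
  have nz : z ^+ (s * i) != 0 by rewrite expf_neq0 ?(prim_root_neq0 prim_z).
  apply: (mulIf nz); rewrite mulVf // -exprD -mulnDr subnK //.
  by rewrite (mulnC s) exprM (prim_expr_order prim_z) // expr1n.
case: l => //= [s||]; first by rewrite zN invrK addrC.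
all: by rewrite -signr_odd oddB // oddM /= signr_odd.
Qed.

(* The correction terms sit at the two central elements a^0 = 1, a^(2h) = -1. *)
Lemma label_trace_torus l i : label_range h l -> (i < 4 * h)%N ->
  \tr (label_rep l (a ^+ i)%g) = label_val_a l i
    + (label_val_e l false - label_val_a l 0) * (i == 0)%:R
    + (label_val_e l true - label_val_a l (2 * h)) * (i == 2 * h)%:R.
Proof.
move=> rl lt_i; have [_ [val_e val_a _ _]] := label_character rl.
have F1 : (#|F|.-1 = 4 * h)%N by rewrite cardF addn1.
have prim_eF : (#|F|.-1).-primitive_root e by rewrite F1.
have eN1 : SL2_e F true = (a ^+ (2 * h))%g.
  by rewrite (SL2_eN1 prim_eF (h := 2 * h)) // F1; lia.
have [->|i0] := posnP i.
  rewrite (_ : (0 == 2 * h)%N = false) ?mulr0 ?addr0; last by lia.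
  by rewrite expg0 -(SL2_e1 F) val_e mulr1 addrC addrNK.
rewrite mulr0 addr0; have [->|/eqP i2h] := eqVneq i (2 * h)%N.
  by rewrite -eN1 val_e mulr1 addrC addrNK.
rewrite mulr0 addr0; have [lt_i2h|gt_i2h] := ltnP i (2 * h); first by rewrite val_a //; lia.
rewrite -(label_val_aN _ (ltnW lt_i)) -val_a; last by clear -lt_i gt_i2h i2h; lia.
have := SL2_aN prim_eF (i := i); rewrite F1 => <-; last exact: ltnW.
by rewrite (mxtrace_SL2_aN prim_eF).
Qed.

Lemma sum_label_torus l y : label_range h l ->
  \sum_(i < 4 * h) \tr (label_rep l (a ^+ i)%g) * y ^+ i =
  \sum_(i < 4 * h) label_val_a l i * y ^+ i + (label_val_e l false - label_val_a l 0)
  + (label_val_e l true - label_val_a l (2 * h)) * y ^+ (2 * h).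
Proof.
move=> rl; have lt0 : (0 < 4 * h)%N by lia.
have lt2h : (2 * h < 4 * h)%N by lia.
under eq_bigr => i _ do rewrite label_trace_torus // mulrDl mulrDl.
rewrite !big_split /=; congr (_ + _ + _).
  rewrite (bigD1 (Ordinal lt0)) //= big1 ?addr0 ?mulr1 // => i i0.
  by rewrite (_ : (i == 0 :> nat) = false) ?mulr0 ?mul0r //; apply: negPf.
rewrite (bigD1 (Ordinal lt2h)) //= big1 ?addr0 ?eqxx ?mulr1 // => i i0.
by rewrite (_ : (i == (2 * h)%N :> nat) = false) ?mulr0 ?mul0r //; apply: negPf.
Qed.

(** The geometric sum of (z^m)^i over T is 4h if 4h divides m and 0 otherwise; the bound on d leaves
    few exponents divisible by 4h. *)
Lemma label_torus_mult l (d : int) : label_range h l -> (`|d| <= 2 * h)%N ->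
  \sum_(i < 4 * h) \tr (label_rep l (a ^+ i)%g) * (z ^ d) ^+ i
  = (4 * h)%:R * (label_mult (expected_mult h d) l)%:R.
Proof.
move=> rl d_le; rewrite sum_label_torus //.
have prim_z : (4 * h).-primitive_root z by rewrite addnK; apply: zeta_primitive; lia.
have nzz := prim_root_neq0 prim_z.
have z2h : z ^+ (2 * h) = -1 by apply: (prim_half prim_z); lia.
have y2h : (z ^ d) ^+ (2 * h) = (-1) ^+ odd `|d|.
  rewrite exprnP exprzAC -exprnP z2h; case: (d) => m; first by rewrite -exprnP /= signr_odd.
  by rewrite -[LHS]/((-1) ^- m.+1) -exprVn invrN1 -[LHS]signr_odd.
have sumz m : \sum_(i < 4 * h) (z ^ m) ^+ i = (4 * h)%:R * (4 * h %| `|m|)%:R.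
  rewrite sum_unity_root ?(exprz_prim_eq1 prim_z) //.
  by rewrite exprnP exprzAC -exprnP (prim_expr_order prim_z) exp1rz.
have dvd_small (m : int) : (`|m| < 4 * h)%N -> (4 * h %| `|m|)%N = (m == 0).
  by case: eqVneq => [->|m0 lt_m]; rewrite ?dvdn0 // gtnNdvd // lt0n absz_eq0.
have sum1 : \sum_(i < 4 * h) 1 * (z ^ d) ^+ i = (4 * h)%:R * (d == 0)%:R.
  under eq_bigr do rewrite mul1r.
  by rewrite sumz dvd_small //; lia.
have nz4 : (4 * h)%:R != 0 :> C by rewrite pnatr_eq0; lia.
have zD m : z ^+ m * z ^ d = z ^ (m%:Z + d) by rewrite expfzDr.
have zB m : z ^- m * z ^ d = z ^ (- m%:Z + d) by rewrite expfzDr // exprnN.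
have sumN1 : \sum_(i < 4 * h) (-1) ^+ i * (z ^ d) ^+ i = (4 * h)%:R * (`|d| == 2 * h)%N%:R.
  under eq_bigr do rewrite -exprMn -z2h zD.
  rewrite sumz; congr (_ * (nat_of_bool _)%:R).
  (* The exponent is 2h + d: it equals 4h, beyond the range of [dvd_small], exactly when d = 2h, and
     0 when d = -2h. *)
  have [d2h|d2h] := eqVneq d (2 * h)%N%:Z.
    rewrite (_ : absz ((2 * h)%N%:Z + d) = (4 * h)%N) ?dvdnn; lia.
  by rewrite dvd_small; lia.
have sumW s : (0 < s < 2 * h)%N ->
    \sum_(i < 4 * h) (z ^+ (s * i) + z ^- (s * i)) * (z ^ d) ^+ i
    = (4 * h)%:R * (`|d|%N == s)%:R.
  move=> s_r; under eq_bigr do rewrite mulrDl !exprM -exprVn -!exprMn zD zB.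
  rewrite big_split /= !sumz -mulrDr -natrD; congr (_ * _%:R).
  by rewrite !dvd_small; lia.
have sgn2h : (-1) ^+ (2 * h) = 1 :> C by rewrite -signr_odd oddM.
have odd2h : odd `|d| -> (`|d| == 2 * h)%N = false by lia.
have odd0 : odd `|d| -> (d == 0) = false by lia.
rewrite y2h; case: l rl => [||s|f||||] rl; rewrite /label_mult /=.
- by rewrite sum1; ring.
- by rewrite sum1; case od: (odd `|d|); rewrite /= ?(odd0 od) ?mulr0n; ring.
- rewrite sumW; last by move: rl => /=; lia.
  rewrite muln0 (mulnC s) exprM z2h -!exprVn !invrN1 !expr0 expr1n expr1.
  by rewrite -(signr_odd C s); case: (odd s); case: (odd _); rewrite /=; ring.
- rewrite addnK big1 => [|i _]; last by rewrite mul0r.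
  rewrite expr0 expr1n expr1 -(signr_odd C f).
  by case: (odd f); case: (odd _); rewrite /=; ring.
- by rewrite sumN1 sgn2h; case od: (odd `|d|); rewrite /= ?(odd2h od) ?mulr0n; ring.
- by rewrite sumN1 sgn2h; case od: (odd `|d|); rewrite /= ?(odd2h od) ?mulr0n; ring.
all: rewrite big1 => [|i _]; last by rewrite mul0r.
all: by case: (odd _); rewrite /=; ring.
Qed.

End Family.

(** * The component over mu e as a representation induced from the torus *)

Section TensorComponent.

Variables (R : realType) (F : finFieldType) (h : nat) (e : F).
Local Notation C := R[i].
Local Notation G := (SL2 F).
Local Notation a := (SL2_a e).
Local Notation q := (4 * h + 1)%N.
Local Notation z := (zeta R (q - 1)).

Hypotheses (h_gt0 : (0 < h)%N) (cardF : #|F| = q) (prim_e : (#|F|.-1).-primitive_root e).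

Variables (mu : bool) (k : nat) (u : 'Z_(q - 1)) (d : int).
Hypothesis k_range : (1 <= k <= 2 * h - 1)%N.
Local Notation kmu := (if mu then (2 * h - k)%N else k).

Variable rho1 : mx_representation C 'C_G[(a ^+ k)%g] 1.
Hypothesis rho1E : is_star ((-1) ^+ mu * u + d%:~R : 'Z_(q - 1)) rho1.
Variable rho2 : mx_representation C 'C_G[(a ^+ kmu)%g] 1.
Hypothesis rho2E : is_star u rho2.

Let cardF1 : #|F|.-1 = (4 * h)%N. Proof. by rewrite cardF addn1. Qed.

Let X := qd_comp (qd_tens (A_obj rho1) (A_obj rho2)) (SL2_e_central F mu).

(** For the sign -, a^(-k) a^(2h) is already a^(2h-k), so n = 1 and the exponents -u + d and u add
    to d. For the sign +, n is the Weyl element, which inverts the second character, and u + d and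
    -u add to d. *)
Lemma A_tens_fusion : exists2 n, n \in G &
  ((a ^+ k)^-1 * SL2_e F mu = n * a ^+ kmu * n^-1)%g
  /\ forall i, (i < 4 * h)%N ->
       \tr (rho1 (a ^+ i)%g) * \tr (rho2 ((a ^+ i) ^ n)%g) = (z ^ d) ^+ i.
Proof.
have q1 : (q - 1 = 4 * h)%N by rewrite addnK.
have n1 : (1 < q - 1)%N by lia.
have prim_z : (q - 1).-primitive_root z by apply: zeta_primitive; lia.
have star1 i : \tr (rho1 (a ^+ i)%g) = (z ^+ (((-1) ^+ mu * u : 'Z_(q - 1))%R) * z ^ d) ^+ i.
  by rewrite rho1E mxtrace_scalar mulr1n (mulnC i) exprM (exp_ZpD n1 prim_z) (exp_Zp_int n1 prim_z).
have star2 i : \tr (rho2 (a ^+ i)%g) = z ^+ (u * i).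
  by rewrite rho2E mxtrace_scalar mulr1n (mulnC i).
have nz : z ^+ u != 0 by rewrite expf_neq0 // (prim_root_neq0 prim_z).
clear rho1E rho2E; case: mu rho1 rho2 star1 star2 => r1 r2 star1 star2.
  exists 1%g => //; split.
    rewrite mul1g invg1 mulg1 -(SL2_eN1 prim_e (h := 2 * h)); last by rewrite cardF1; lia.
    have -> : (2 * h = k + (2 * h - k))%N by lia.
    by rewrite expgD mulKg addKn.
  move=> i _; rewrite conjg1 star1 star2 expr1 mulN1r (exp_ZpN n1 prim_z).
  by rewrite exprMn exprVn exprM mulrAC mulVf ?mul1r // expf_neq0.
have [w Gw wE] := SL2_weyl prim_e.
exists w => //; split.
  by rewrite SL2_e1 mulg1; case: (wE k).
move=> i lt_i; have aN := SL2_aN prim_e (i := i); rewrite cardF1 in aN.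
have -> : \tr (r2 ((a ^+ i) ^ w)%g) = z ^+ (u * (4 * h - i)).
  by have [-> _] := wE i; rewrite aN ?(ltnW lt_i).
rewrite star1 expr0 mul1r exprMn mulrAC.
rewrite -exprM -exprD -mulnDr subnKC ?(ltnW lt_i) //.
have z4h : z ^+ (4 * h) = 1 by rewrite -[X in z ^+ X]q1 (prim_expr_order prim_z).
by rewrite (mulnC u) exprM z4h expr1n mul1r.
Qed.

Lemma cent_a : 'C_G[(a ^+ k)%g] = <[a]>%g.
Proof. by apply: (cent_SL2_a prim_e); rewrite cardF1; apply/negP => /dvdn_leq; lia. Qed.

Lemma sum_cent_a (f : {'GL_2[F]} -> C) :
  \sum_(t in 'C_G[(a ^+ k)%g]) f t = \sum_(i < 4 * h) f (a ^+ i)%g.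
Proof.
have := sum_cycle_SL2_a prim_e f; rewrite cardF1 => <-.
by apply: eq_bigl => t; rewrite cent_a.
Qed.

Lemma card_cent_a : #|'C_G[(a ^+ k)%g]| = (4 * h)%N.
Proof. by rewrite cent_a -cardF1 -(order_SL2_a prim_e). Qed.

Lemma A_tens_dot m (S : mx_representation C G m) :
  repr_dot S X = (4 * h)%:R^-1 * \sum_(i < 4 * h) \tr (S (a ^+ i)%g) * (z ^ d) ^+ i.
Proof.
have [n Gn [fus val]] := A_tens_fusion.
pose psi t := \tr (rho1 t) * \tr (rho2 (t ^ n)%g).
rewrite (repr_dot_ind (H := 'C_G[(a ^+ k)%g]%G) (psi := psi) S (subsetIl _ _)) => [|g Gg].
  rewrite card_cent_a sum_cent_a; congr (_ * _); apply: eq_bigr => i _.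
  by rewrite (mxtrace_SL2_aN prim_e) -val.
rewrite (mxtrace_qd_simple_tens _ _ _ _ _ Gn fus Gg); congr (_ * _).
by apply: eq_bigr => b _; rewrite /psi conjgM.
Qed.

(** The induced character at 1 is the index of T in G. *)
Lemma A_tens_dim : rdegree X = ((4 * h + 1) * (4 * h + 2))%N.
Proof.
have [n Gn [fus val]] := A_tens_fusion.
apply/eqP; rewrite -(eqr_nat C) -[X in X == _](mxtrace1 C) -(repr_mx1 X).
rewrite (mxtrace_qd_simple_tens _ _ _ _ _ Gn fus (group1 _)) card_cent_a.
rewrite (eq_bigr (fun=> 1)) => [|b Gb]; last first.
  have /val : (0 < 4 * h)%N by lia.
  by rewrite expg0 !conj1g group1.
rewrite sumr_const card_SL2 cardF1 cardF; apply/eqP.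
have nz : (4 * h)%:R != 0 :> C by rewrite pnatr_eq0; lia.
by apply: (mulfI nz); rewrite mulVKf // -natrM; congr _%:R; lia.
Qed.

End TensorComponent.

(** * Existence and uniqueness of the decomposition *)

Section Multiplicities.

Variables (R : realType) (F : finFieldType) (h : nat) (e : F) (c : {'GL_2[F]}).
Variable I : SL2_family R F.
Hypotheses (h_gt0 : (0 < h)%N) (I_table : SL2_character_table h e c I) (c_SL2 : c \in SL2 F).

Lemma SL2_sum_dot N l : label_range h l ->
  repr_dot (label_rep I l) (SL2_sum h I N) = (label_mult N l)%:R.
Proof.
move=> rl; rewrite (repr_dot_lincomb _ (fun g _ => mxtrace_SL2_sum h I N g)).
rewrite (bigD1_seq l) ?uniq_SL2_labels ?mem_SL2_labels //=.
rewrite (repr_dot_irr (label_irr I_table rl)) mulr1 big1_seq ?addr0 // => l' /andP[l'l].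
rewrite mem_SL2_labels // => rl'; rewrite (label_dot0 h_gt0 I_table) ?mulr0 //.
by rewrite eq_sym.
Qed.

Lemma rsim_SL2_sum N m (X : mx_representation R[i] (SL2 F) m) :
  {in label_range h, forall l, repr_dot (label_rep I l) X = (label_mult N l)%:R} ->
  m = (\sum_(l <- SL2_labels h) label_mult N l * label_deg h l)%N ->
  mx_rsim X (SL2_sum h I N).
Proof.
move=> multX dimX; apply: eq_mxtrace_rsim => g Gg; rewrite mxtrace_SL2_sum.
apply: mxtrace_of_mult => //; first exact: uniq_SL2_labels.
- by move=> l; rewrite mem_SL2_labels // => rl; exact: (label_irr I_table rl).
- move=> l l'; rewrite !mem_SL2_labels // => rl rl'; exact: (label_dot0 h_gt0 I_table c_SL2 rl rl').
- by move=> l; rewrite mem_SL2_labels // => rl; apply: multX.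
rewrite dimX; apply: eq_big_seq => l; rewrite mem_SL2_labels // => rl.
by rewrite (label_degree I_table).
Qed.

End Multiplicities.

(** The generator of the units of L has order q^2 - 1 = 2(2h + 1) * 4h, so its power with exponent
    2(2h + 1) has order 4h. *)
Lemma primitive_root_iota (F L : finFieldType) (iota : {rmorphism F -> L}) q h
    (ce : {unit L}) e : (0 < h)%N -> q = (4 * h + 1)%N -> #|L| = (q ^ 2)%N ->
  generator [set: {unit L}] ce -> iota e = (FinRing.uval ce ^+ (2 * h + 1)) ^+ 2 ->
  (4 * h).-primitive_root e.
Proof.
move=> h_gt0 -> cardL gen_ce eE; rewrite -(fmorph_primitive_root iota) eE -exprM.
have := primitive_root_generator gen_ce; rewrite cardL => prim_ce.
have L1 : (((4 * h + 1) ^ 2).-1 = ((2 * h + 1) * 2) * (4 * h))%N by rewrite -subn1; lia.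
have := dvdn_prim_root prim_ce (m := 4 * h); rewrite L1 dvdn_mull // mulnK; last by lia.
by apply.
Qed.

Lemma SL2_c_in (F L : finFieldType) (iota : {rmorphism F -> L}) (c : {'GL_2[F]})
    (f t : L) : odd #|L| -> f != 0 -> t != 0 ->
  map_mx iota (GLval c) =
    mx2 ((f + f^-1) / 2) ((f - f^-1) / 2 * t^-1) ((f - f^-1) / 2 * t) ((f + f^-1) / 2) ->
  c \in SL2 F.
Proof.
move=> oddL nzf nzt cE; rewrite inE -(fmorph_eq1 iota) -det_map_mx cE det_mx2.
(* The odd number |L| annihilates the additive group of L, so 2 = 0 would give 1 = 0. *)
have nz2 : 2 != 0 :> L.
  apply/eqP => L2; have : #|L|%:R = 0 :> L.
    by have := expg_cardG (in_setT (1 : L)); rewrite FinRing.zmodXgE cardsT.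
  rewrite -(odd_double_half #|L|) oddL natrD -muln2 natrM L2 mulr0 addr0.
  by apply/eqP; rewrite oner_eq0.
apply/eqP; field; rewrite ?nzf ?nzt ?nz2 //.
Qed.

Theorem mainTheorem8 (R : realType) (p n q h : nat) (p_pr : prime p) (p_odd : odd p)
  (q_pn : q = (p ^ n)%N) (q_ge5 : (5 <= q)%N) (q_4h1 : q = (4 * h + 1)%N)
  (F L : finFieldType) (cardF : #|F| = q) (cardL : #|L| = (q ^ 2)%N)
  (iota : {rmorphism F -> L})
  (ce : {unit L}) (ce_gen : generator [set: {unit L}] ce)
  (e : F) (c : {'GL_2[F]})
  (eE : let et := FinRing.uval ce ^+ (2 * h + 1) in iota e = et ^+ 2)
  (cE : let et := FinRing.uval ce ^+ (2 * h + 1) in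
        let f := FinRing.uval ce ^+ (4 * h) in
        let s1 := (f + f^-1) / 2 in
        let s1' := (f - f^-1) / 2 in
        map_mx iota (GLval c) = mx2 s1 (s1' * et^-1) (s1' * et) s1)
  (I : SL2_family R F) (I_table : SL2_character_table h e c I)
  (mu : bool) (k : nat) (k_range : (1 <= k <= 2 * h - 1)%N)
  (u : 'Z_(q - 1)) (d : int) (d_le : (`|d| <= 2 * h)%N)
  (rho1 : mx_representation R[i] 'C_(SL2 F)[(SL2_a e ^+ k)%g] 1)
  (rho1E : is_star ((-1) ^+ mu * u + d%:~R : 'Z_(q - 1)) rho1)
  (k_mu := if mu then (2 * h - k)%N else k)
  (rho2 : mx_representation R[i] 'C_(SL2 F)[(SL2_a e ^+ k_mu)%g] 1)
  (rho2E : is_star u rho2) :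
  let X := qd_tens (A_obj rho1) (A_obj rho2) in
  let X_mu := qd_comp X (SL2_e_central F mu) in
  (exists N : SL2_mult, mx_rsim X_mu (SL2_sum h I N)) /\
  forall N : SL2_mult, mx_rsim X_mu (SL2_sum h I N) ->
    (~~ odd `|d| ->
      [/\ mult_W' N = (1 + (`|d| == 2 * h))%N /\ mult_W'' N = (1 + (`|d| == 2 * h))%N,
          mult_1 N = (d == 0),
          forall s, (1 <= s <= 2 * h - 1)%N ->
            mult_W N s = (2 * (2 %| s) + (`|d| == s))%N,
          mult_X' N = 0%N /\ mult_X'' N = 0%N &
          mult_V N = (2 + (d == 0))%N /\
          forall f, (1 <= f <= 2 * h)%N -> mult_X N f = (2 * (2 %| f))%N]) /\
    (odd `|d| ->
      [/\ mult_W' N = 0%N /\ mult_W'' N = 0%N,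
          mult_1 N = 0%N,
          forall s, (1 <= s <= 2 * h - 1)%N ->
            mult_W N s = (2 * ~~ (2 %| s) + (`|d| == s))%N,
          mult_X' N = 1%N /\ mult_X'' N = 1%N &
          mult_V N = 0%N /\
          forall f, (1 <= f <= 2 * h)%N -> mult_X N f = (2 * ~~ (2 %| f))%N]).
Proof.
move=> X X_mu; have h_gt0 : (0 < h)%N by lia.
have prim_e := primitive_root_iota h_gt0 q_4h1 cardL ce_gen eE.
have c_SL2 : c \in SL2 F.
  have nz : FinRing.uval ce != 0 by rewrite -unitfE; apply: valP.
  apply: SL2_c_in cE; rewrite ?expf_neq0 // cardL q_4h1 oddX oddD oddM.
  by [].
clear cE eE ce_gen ce cardL iota L p_pr p_odd q_pn q_ge5 p n.
subst q.
have prim_eF : (#|F|.-1).-primitive_root e by rewrite cardF addn1.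
have dimX : rdegree X_mu = _ := A_tens_dim h_gt0 cardF prim_eF k_range rho1E rho2E.
have nz4 : (4 * h)%:R != 0 :> R[i] by rewrite pnatr_eq0; lia.
have multX l : label_range h l ->
    repr_dot (label_rep I l) X_mu = (label_mult (expected_mult h d) l)%:R.
  move=> rl; rewrite (A_tens_dot h_gt0 cardF prim_eF k_range rho1E rho2E).
  by rewrite (label_torus_mult h_gt0 I_table cardF prim_e rl d_le) mulKf.
split.
  exists (expected_mult h d); apply: (rsim_SL2_sum h_gt0 I_table c_SL2) => //.
  by rewrite (sum_label_deg h_gt0 d_le).
move=> N simN.
(* Pairing with the irreducible labelled l reads off its multiplicity in any decomposition, so it
   equals the one computed on the torus. *)
have multN l : label_range h l -> label_mult N l = label_mult (expected_mult h d) l.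
  move=> rl; apply/eqP; rewrite -(eqr_nat R[i]) -multX // -(SL2_sum_dot h_gt0 I_table c_SL2) //.
  by apply/eqP/esym/eq_repr_dotr/mxtrace_rsim.
have := multN Lab1 isT; have := multN LabV isT.
have := multN LabW' isT; have := multN LabW'' isT.
have := multN LabX' isT; have := multN LabX'' isT.
have multW s := multN (LabW s); have multX' f := multN (LabX f).
rewrite /= in multW multX' * => -> -> -> -> -> ->.
split=> odd_d; rewrite ?(negPf odd_d) ?odd_d.
  by split=> // [s s_r|]; [|split=> // f f_r]; rewrite ?multW ?multX' // dvdn2 (negPf odd_d) eqbF_neg.
split=> //; first by move: odd_d; case: eqP => // ->.
  by move=> s s_r; rewrite multW // dvdn2 negbK odd_d eqb_id.
by split=> // f f_r; rewrite multX' // dvdn2 negbK odd_d eqb_id.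
Qed.
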